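(* For any regular quadruple of weights $(\lambda,\lambda',\lambda'',\lambda''')$, one has $$(\mathbf T_{\lambda,\lambda',\lambda''\lambda'''})_{23}\,(\mathbf T_{\lambda\lambda',\lambda'',\lambda'''})_{12}=(\mathbf T_{\lambda',\lambda'',\lambda'''})_{12}\,(\mathbf T_{\lambda,\lambda'\lambda'',\lambda'''})_{13}\,(\mathbf T_{\lambda,\lambda',\lambda''})_{23}$$ as maps $M^{\lambda\lambda'\lambda''\lambda'''}_{\lambda\lambda'\lambda'',\lambda'''}\otimes M^{\lambda\lambda'\lambda''}_{\lambda\lambda',\lambda''}\otimes M^{\lambda\lambda'}_{\lambda,\lambda'}\to M^{\lambda''\lambda'''}_{\lambda'',\lambda'''}\otimes M^{\lambda'\lambda''\lambda'''}_{\lambda',\lambda''\lambda'''}\otimes M^{\lambda\lambda'\lambda''\lambda'''}_{\lambda,\lambda'\lambda''\lambda'''}$.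
   Context: $N$ is a fixed odd positive integer, $q=e^{\pi\sqrt{-1}/N}$. $\mathcal W$ is the Hopf algebra over $\mathbb C$ generated by $X^{\pm1},Y$ with $XY=q^2YX$, $\Delta X=X\otimes X$, $\Delta Y=Y\otimes X+1\otimes Y$, $\epsilon(X)=1$, $\epsilon(Y)=0$, $S(X)=X^{-1}$, $S(Y)=-YX^{-1}$. Representations are finite dimensional complex left $\mathcal W$-modules; tensor products are formed via $\Delta$; a representation is trivial if each $W$ acts by $\epsilon(W)\,\mathrm{id}$. $e_0,\dots,e_{N-1}$ is the standard basis of $\mathbb C^N$, indices mod $N$; $Ae_k=q^{2k}e_k$, $Be_k=e_{k+1}$. For each $z\in\mathbb C^\times$ an $N$-th root $z^{1/N}$ is fixed, with $1^{1/N}=1$, $(z^{1/N})^{-1}=(z^{-1})^{1/N}=:z^{-1/N}$, $(-z)^{1/N}=-z^{1/N}$; $m_{z,w}\in\{0,\dots,N-1\}$ is defined by $(zw)^{1/N}=q^{2m_{z,w}}z^{1/N}w^{1/N}$. Subscripts on operators indicate the tensor factors acted on ($A_2=\mathrm{id}\otimes A$ etc.; $O_{ij}$ means a two-factor operator $O$ applied with its first slot at factor $i$ and its second slot at factor $j$). A weight is a pair $\lambda=(x,y)\in\mathbb C^2$, non-singular if $x,y\neq0$. Product: $(x,y)(x',y')=(xx',yx'+y')$. For non-singular $\lambda=(x,y)$, $V_\lambda$ is $\mathbb C^N$ with $X$ acting by $x^{1/N}A$, $Y$ by $y^{1/N}B$. A sequence of non-singular weights $(\lambda_1,\dots,\lambda_n)$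 is regular if $X$ and $Y$ act invertibly on $V_{\lambda_i}\otimes\cdots\otimes V_{\lambda_j}$ for all $i\le j$ (equivalently all products $\lambda_i\cdots\lambda_j$ are non-singular). For a regular pair, $M^{\lambda\lambda'}_{\lambda,\lambda'}$ denotes $\mathbb C^N$ as a trivial representation. For $\mathbf a,\mathbf c\in\mathbb C$ with $\mathbf c^N-\mathbf a^N=1$ put $w(\mathbf a,\mathbf c|0)=1$, $w(\mathbf a,\mathbf c|n)=\prod_{j=1}^n(\mathbf c-\mathbf a q^{2j})^{-1}$ ($N$-periodic in $n$). For an operator $C$ with $C^N=\mathrm{id}$, $\Phi^q_{\mathbf a,\mathbf c}(C)$ acts on the $q^{2i}$-eigenspace of $C$ by $\zeta_{\mathbf a,\mathbf c}w(\mathbf a,\mathbf c|i)$, with $\zeta_{\mathbf a,\mathbf c}$ a fixed nonzero constant. For a regular pair $\lambda=(x,y),\lambda'=(x',y')$, $\mathbf F_{\lambda,\lambda'}=B_2^{-m_{x,x'}}\,\mathbf S\,\Phi^q_{\mathbf a,\mathbf c}(B_1A_2B_2^{-1})$, where $\mathbf S(e_i\otimes e_j)=e_i\otimes e_{i+j}$, $\mathbf a=-\frac{y^{1/N}(x')^{1/N}}{(yx'+y')^{1/N}}$, $\mathbf c=\frac{(y')^{1/N}}{(yx'+y')^{1/N}}$; it is a $\mathcal W$-isomorphism $V_\lambda\otimes V_{\lambda'}\to M^{\lambda\lambda'}_{\lambda,\lambda'}\otimes V_{\lambda\lambda'}$. For a regular triple, $\mathbf T_{\lambda,\lambda',\lambda''}: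 M^{\lambda\lambda'\lambda''}_{\lambda\lambda',\lambda''}\otimes M^{\lambda\lambda'}_{\lambda,\lambda'}\to M^{\lambda'\lambda''}_{\lambda',\lambda''}\otimes M^{\lambda\lambda'\lambda''}_{\lambda,\lambda'\lambda''}$ is the unique invertible linear map with $(\mathbf F_{\lambda,\lambda'\lambda''})_{13}(\mathbf F_{\lambda',\lambda''})_{23}(\mathbf F_{\lambda,\lambda'})_{12}^{-1}(\mathbf F_{\lambda\lambda',\lambda''})_{23}^{-1}=(\mathbf T_{\lambda,\lambda',\lambda''})_{21}$ on $\mathbb C^N\otimes\mathbb C^N\otimes\mathbb C^N$. *)

(* Defs.v *)
From mathcomp Require Import all_boot all_order all_algebra.
From mathcomp Require Import complex.
From mathcomp Require Import classical_sets reals trigo.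

Set Implicit Arguments.
Unset Strict Implicit.
Unset Printing Implicit Defensive.
Import Order.TTheory GRing.Theory Num.Theory.
Local Open Scope ring_scope.

(* A choice z |-> z^{1/N} of N-th roots of the nonzero elements of C. *)
Record root_choice (C : fieldType) (N : nat) := RootChoice {
  nroot :> C -> C;
  nrootK : forall z, z != 0 -> nroot z ^+ N = z;
  nroot1 : nroot 1 = 1;
  nrootV : forall z, z != 0 -> (nroot z)^-1 = nroot z^-1;
  nrootN : forall z, z != 0 -> nroot (- z) = - nroot z }.

Section Tensors.
Context (C : fieldType) (p : nat).

(* N = p.+1, so that 'I_N carries the addition of Z/N (for N = 1 as well).
   The basis of (C^N)^{(x) n} is indexed by the functions 'I_n -> 'I_N, and
   Tens n is the space of coordinate vectors in this basis. *)
Definition idx (n : nat) := {ffun 'I_n -> 'I_p.+1}.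
Definition Tens (n : nat) := {ffun idx n -> C^o}.
Definition Op (n : nat) := 'End(Tens n).

Definition ebasis n (t : idx n) : Tens n := [ffun s => (s == t)%:R].

Definition on_basis n (f : idx n -> Tens n) : Op n :=
  linfun (fun v : Tens n => \sum_t (v t : C) *: f t).

Definition invertible n (f : Op n) : Prop :=
  exists g : Op n, (g \o f)%VF = \1%VF /\ (f \o g)%VF = \1%VF.

Definition powop n (f : Op n) (m : nat) : Op n := iter m (comp_lfun f) \1%VF.

(* The entry of t at position f k is replaced by s k, for every k. *)
Definition update k n (f : 'I_k -> 'I_n) (t : idx n) (s : idx k) : idx n :=
  [ffun i => if [pick j | f j == i] is Some j then s j else t i].

(* For injective f, O applied to n factors with its j-th slot at the factor
   f j, and the identity on the other factors. *)
Definition legs k n (f : 'I_k -> 'I_n) (O : Op k) : Op n :=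
  on_basis (fun t =>
    \sum_(s : idx k)
       (O (ebasis [ffun j => t (f j)]) s : C) *: ebasis (update f t s)).

(* O_i and O_{ij} on n.+1 factors; as in the usual leg notation, i and j are
   numbered from 1. *)
Definition at1 {n} (i : nat) (O : Op 1) : Op n.+1 :=
  legs (fun _ : 'I_1 => inord i.-1 : 'I_n.+1) O.
Definition at2 {n} (i j : nat) (O : Op 2) : Op n.+1 :=
  legs (fun k : 'I_2 => inord (if k == ord0 then i.-1 else j.-1) : 'I_n.+1) O.

(* The operators by which the generators X and Y of the Hopf algebra W act on
   a representation carried by (C^N)^{(x) n}. *)
Record genact (n : nat) := GenAct { actX : Op n; actY : Op n }.

(* Delta X = X (x) X and Delta Y = Y (x) X + 1 (x) Y. *)
Definition tensor m n (V : genact m) (W : genact n) : genact (m + n) :=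
  let on_left := legs (@lshift m n) in
  let on_right := legs (@rshift m n) in
  GenAct (on_left (actX V) \o on_right (actX W))%VF
         ((on_left (actY V) \o on_right (actX W))%VF + on_right (actY W)).

Definition weight := (C * C)%type.

Definition nonsingular (l : weight) : bool := (l.1 != 0) && (l.2 != 0).

Definition wmul (l l' : weight) : weight :=
  (l.1 * l'.1, l.2 * l'.1 + l'.2).

End Tensors.

Arguments Tens C p n : clear implicits.
Arguments Op C p n : clear implicits.

Declare Scope weight_scope.
Delimit Scope weight_scope with W.
Notation "l ** l'" := (wmul l l') (at level 40, left associativity)
  : weight_scope.

Section Pentagon.
Context (R : realType) (p : nat).
Local Notation C := R[i].
Local Notation N := p.+1.
Context (rt : root_choice C N) (zeta : C -> C -> C).

Definition q : C := (cos (pi / N%:R) +i* sin (pi / N%:R))%C.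

Definition opA : Op C p 1 :=
  on_basis (fun t => q ^+ (2 * t ord0) *: ebasis C t).
Definition opB : Op C p 1 :=
  on_basis (fun t => ebasis C [ffun k => ordS (t k)]).

(* e_i (x) e_j |-> e_i (x) e_{i+j} *)
Definition opS : Op C p 2 :=
  on_basis (fun t => ebasis C
    [ffun k : 'I_2 => if k == ord0 then t ord0 else t ord0 + t ord_max]).

Definition Vrep (l : weight C) : genact C p 1 :=
  GenAct (rt l.1 *: opA) (rt l.2 *: opB).

(* V_l (x) V_{l_1} (x) ... (x) V_{l_k} for s = [:: l_1; ...; l_k] *)
Fixpoint Vtens (l : weight C) (s : seq (weight C)) : genact C p (size s).+1 :=
  match s with
  | [::] => Vrep l
  | l1 :: s1 => tensor (Vrep l) (Vtens l1 s1)
  end.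

Definition regular (s : seq (weight C)) : Prop :=
  all (@nonsingular C) s /\
  forall l s', infix (l :: s') s ->
    invertible (actX (Vtens l s')) /\ invertible (actY (Vtens l s')).

(* m_{z,w}; the default value is not reached for nonzero z and w. *)
Definition mroot (z w : C) : 'I_N :=
  odflt ord0 [pick m : 'I_N | rt (z * w) == q ^+ (2 * m) * rt z * rt w].

Definition wfun (a c : C) (n : nat) : C :=
  \prod_(1 <= j < n.+1) (c - a * q ^+ (2 * j))^-1.

Definition eigsp n (U : Op C p n) (i : 'I_N) := passmx.leigenspace U (q ^+ (2 * i)).

(* When U^N = id, the whole space is the direct sum of the q^{2i}-eigenspaces
   of U, and daddv_pi is the projection onto the i-th one along the others. *)
Definition Phi n (a c : C) (U : Op C p n) : Op C p n :=
  \sum_(i < N) (zeta a c * wfun a c i) *: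
     daddv_pi (eigsp U i) (\sum_(j < N | j != i) eigsp U j)%VS.

Definition opF (l l' : weight C) : Op C p 2 :=
  let: (x, y) := l in
  let: (x', y') := l' in
  let d := rt (y * x' + y') in
  let a := - (rt y * rt x' / d) in
  let c := rt y' / d in
  let Binv2 : Op C p 2 := (at1 2 opB)^-1%VF in
  (powop Binv2 (mroot x x') \o
     opS \o Phi a c (at1 1 opB \o at1 2 opA \o Binv2))%VF.

Local Open Scope weight_scope.

Definition is_opT (l l' l'' : weight C) (T : Op C p 2) : Prop :=
  invertible T /\
  (at2 1 3 (opF l (l' ** l'')) \o at2 2 3 (opF l' l'') \o
     (at2 1 2 (opF l l'))^-1 \o (at2 2 3 (opF (l ** l') l''))^-1)%VF
  = at2 2 1 T :> Op C p 3.

(* The T with is_opT l l' l'' T, which exists and is unique when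
   [:: l; l'; l''] is regular. *)
Definition opT (l l' l'' : weight C) : Op C p 2 :=
  xget 0 [set T | is_opT l l' l'' T]%classic.

End Pentagon.

(* Main.v *)
(* By a discrete Fourier decomposition with respect to U = B_1 A_2 B_2^{-1}, whose
   N-th power is 1 because N is odd, Phi(U) satisfies a difference equation which
   makes F_{l,l'} intertwine the action of W on V_l (x) V_l' with its action on
   the second factor of M (x) V_{ll'}.  For a triple, the quotient of the two ways
   of fusing V_l (x) V_l' (x) V_l'' therefore commutes with A and B acting on the
   last factor; these generate the full matrix algebra, so the quotient acts on the
   multiplicity factors only, and T exists.  Expressing each T through F on four
   factors, the two sides of the pentagon compare the same two ways of fusing
   V_l (x) V_l' (x) V_l'' (x) V_l''', and the fourth factor can be dropped.

   Non-singularity of the products of weights follows from the invertibility of Y: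
   on a tensor product the q-binomial formula gives Y^N = y, the second coordinate
   of the product of the weights. *)

Require Import Defs.
From HB Require Import structures.
From mathcomp Require Import all_boot all_order all_algebra.
From mathcomp Require Import complex.
From mathcomp Require Import classical_sets reals trigo.
Import Order.TTheory GRing.Theory Num.Theory.
Local Open Scope ring_scope.
Local Open Scope weight_scope.
Set Implicit Arguments.
Unset Strict Implicit.
Unset Printing Implicit Defensive.

(** * Operators as an algebra *)

Section OpAlgebra.
Context (C : fieldType) (p n : nat).

(** The index set is nonempty even for [n = 0], so the identity is nonzero; composition then makes
    [Op C p n] a nonzero ring and a [C]-algebra. *)
Lemma one_Op_neq0 : \1%VF != 0 :> Op C p n.
Proof.
apply/eqP => /lfunP/(_ (ebasis C [ffun=> ord0])) /ffunP/(_ [ffun=> ord0])/eqP.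
by rewrite !lfunE /= !ffunE eqxx oner_eq0.
Qed.

HB.instance Definition _ := GRing.Lmodule.on (Op C p n).
HB.instance Definition _ :=
  GRing.Zmodule_isNzRing.Build (Op C p n)
    (@comp_lfunA _ _ _ _ _) (@comp_lfun1l _ _ _) (@comp_lfun1r _ _ _)
    (@comp_lfunDl _ _ _ _) (@comp_lfunDr _ _ _ _) one_Op_neq0.
HB.instance Definition _ := GRing.Lmodule_isLalgebra.Build C (Op C p n)
  (fun k f g => comp_lfunZl k f g).
HB.instance Definition _ := GRing.Lalgebra_isAlgebra.Build C (Op C p n)
  (fun k f g => comp_lfunZr k f g).

Lemma mulOpE (f g : Op C p n) : (f \o g)%VF = f * g.
Proof. by []. Qed.
End OpAlgebra.

(** * q-commuting elements and spectral calculus *)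

Lemma sum_ord_periodic (V : zmodType) (f : nat -> V) n :
  f n = f 0 -> \sum_(j < n) f j.+1 = \sum_(j < n) f j.
Proof.
move=> fn0; apply: (addrI (f 0)).
by rewrite -(big_ord_recl n (fun j => f j)) big_ord_recr /= fn0 addrC.
Qed.

Section QCommute.
Context (F : fieldType) (A : algType F) (N : nat) (w : F).
Implicit Types (x y u v : A).

Lemma qcommX k x y n : x * y = k *: (y * x) -> x ^+ n * y = k ^+ n *: (y * x ^+ n).
Proof.
move=> xy; elim: n => [|n IH]; first by rewrite !expr0 mul1r mulr1 scale1r.
rewrite [x ^+ _]exprSr -mulrA xy -scalerAr [x ^+ n * (y * x)]mulrA IH -scalerAl scalerA.
by rewrite -mulrA -exprS.
Qed.

Lemma exprM_qcomm k x y n : x * y = k *: (y * x) ->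
  (y * x) ^+ n = k ^+ 'C(n, 2) *: (y ^+ n * x ^+ n).
Proof.
move=> xy; elim: n => [|n IH]; first by rewrite !expr0 mul1r scale1r.
rewrite exprSr IH -scalerAl -mulrA [x ^+ n * _]mulrA (qcommX n xy).
rewrite -scalerAl -scalerAr scalerA -exprD binS bin1 !mulrA -exprSr -mulrA.
by rewrite -exprSr addnC.
Qed.

Hypotheses (oddN : odd N) (w_prim : N.-primitive_root w).

(** For odd [N] the number N(N-1)/2 is a multiple of [N]. This removes the scalars gathered when
    q-commuting factors are reordered inside an [N]-th power. *)
Lemma expr_bin2_odd k : k ^+ N = 1 -> k ^+ 'C(N, 2) = 1 :> F.
Proof.
move=> kN; rewrite bin2 -divn2 -muln_divA ?exprM ?kN ?expr1n //.
by rewrite dvdn2 -subn1 oddB ?oddN // odd_gt0.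
Qed.

Lemma prod_sub_root (a c : F) : \prod_(0 <= j < N) (c - a * w ^+ j) = c ^+ N - a ^+ N.
Proof.
have [->|a0] := eqVneq a 0.
  rewrite expr0n eqn0Ngt odd_gt0 // subr0.
  by under eq_bigr do rewrite mul0r subr0; rewrite prodr_const_nat subn0.
have -> : c ^+ N - a ^+ N = ('X^N - 1 : {poly F}).[c / a] * a ^+ N.
  rewrite !hornerE mulrBl mul1r expr_div_n divfK //.
  by rewrite expf_neq0.
rewrite -(factor_Xn_sub_1 w_prim) horner_prod.
rewrite -[X in a ^+ X]subn0 -prodr_const_nat -big_split /=.
by apply: eq_bigr => j _; rewrite !hornerE mulrBl divfK // mulrC [w ^+ _ * _]mulrC.
Qed.

Lemma prim_neq0 : w != 0.
Proof.
apply: contra_eq_neq (prim_expr_order w_prim) => ->.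
by rewrite expr0n eqn0Ngt odd_gt0 // eq_sym oner_eq0.
Qed.

(** The factorization of X^N - 1 is evaluated at [x] through [horner_alg]; the scalars taken out of
    the factors multiply to w^(N(N-1)/2) = 1. *)
Lemma prod_scale_sub_root x :
  \prod_(0 <= j < N) (w ^- j *: x - 1) = x ^+ N - 1.
Proof.
have -> : x ^+ N - 1 = horner_alg x ('X^N - 1).
  by rewrite rmorphB rmorphXn rmorph1 /= horner_algX.
rewrite -(factor_Xn_sub_1 w_prim) rmorph_prod /=.
have -> : \prod_(0 <= j < N) horner_alg x ('X - (w ^+ j)%:P) =
          \prod_(0 <= j < N) (w ^+ j *: (w ^- j *: x - 1)).
  apply: eq_bigr => j _.
  rewrite [in LHS]raddfB /= horner_algX horner_algC scalerBr scalerA divff //.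
    by rewrite scale1r.
  by rewrite expf_neq0 // prim_neq0.
rewrite scaler_prod.
rewrite prodrXr bin2_sum expr_bin2_odd ?scale1r //.
exact: prim_expr_order.
Qed.

(** The q-binomial formula at a primitive root of unity. As [v] is invertible, [u + v] equals -(y -
    1)v with y = -u v^-1; its powers are, up to sign, products of the factors [w ^- j *: y - 1]
    times powers of [v], and at exponent [N] the product closes up to y^N - 1. *)
Lemma exprD_qcomm u v v' :
  u * v = w *: (v * u) -> v * v' = 1 -> v' * v = 1 ->
  (u + v) ^+ N = u ^+ N + v ^+ N.
Proof.
move=> uv vv' v'v.
have w0 := prim_neq0.
have wN := prim_expr_order w_prim.
pose y := - (u * v').
have yv : y * v = - u by rewrite mulNr -mulrA v'v mulr1.
have vy : v * y = w^-1 *: (y * v).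
  apply: (can_inj (scalerK w0)); rewrite scalerA divff // scale1r yv.
  by rewrite mulrN scalerN mulrA scalerAl -uv -mulrA vv' mulr1.
have step n : ((u + v) ^+ n) = (-1) ^+ n *: (\prod_(0 <= j < n) (w ^- j *: y - 1) * v ^+ n).
  elim: n => [|n IH]; first by rewrite big_geq // !expr0 mulr1 scale1r.
  rewrite exprSr IH.
  have -> : u + v = - ((y - 1) * v) by rewrite mulrBl yv mul1r -opprD opprK.
  rewrite mulrN -scalerAl [(-1) ^+ n.+1]exprSr mulrN1 scaleNr; congr (- (_ *: _)).
  rewrite big_nat_recr //= -!mulrA; congr (_ * _).
  rewrite mulrA mulrBr (qcommX n vy) mulr1 exprVn [v ^+ n.+1]exprSr [RHS]mulrA.
  by rewrite [in RHS]mulrBl mul1r -scalerAl.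
rewrite step prod_scale_sub_root mulrBl mul1r.
have := exprM_qcomm N vy; rewrite yv expr_bin2_odd ?exprVn ?wN ?invr1 //.
have sN (B : pzRingType) : (-1) ^+ N = -1 :> B by rewrite -signr_odd oddN.
by rewrite scale1r => <-; rewrite (exprNn u) !sN scaleN1r mulN1r opprB opprK addrC.
Qed.

End QCommute.

Section Spectral.
Context (F : fieldType) (A : algType F) (N : nat) (w : F).
Hypotheses (w_prim : N.-primitive_root w) (N_neq0 : N%:R != 0 :> F).
Implicit Types (U B : A) (g h : nat -> F).

(* The projector onto the w^i-eigenspace of U, when U^N = 1 *)
Definition eigproj U (i : nat) : A := N%:R^-1 *: \sum_(j < N) w ^- (i * j) *: U ^+ j.

(** Functional calculus: [g] is a function of the exponent i of the eigenvalue w^i. [PhiE] puts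
    [Phi] in this form. *)
Definition fcalc g U : A := \sum_(i < N) g i *: eigproj U i.

Let wN : w ^+ N = 1. Proof. exact: prim_expr_order. Qed.
Let w0 : w != 0.
Proof.
apply: contra_eq_neq wN => ->.
rewrite expr0n -[N == 0]negbK -lt0n (prim_order_gt0 w_prim) /=.
by rewrite eq_sym oner_eq0.
Qed.

Lemma sum_root_powers (x : F) :
  x ^+ N = 1 -> \sum_(j < N) x ^+ j = (x == 1)%:R * N%:R.
Proof.
move=> xN; have [->|x1] := eqVneq.
  by rewrite mul1r; under eq_bigr do rewrite expr1n; rewrite sumr_const card_ord.
apply: (mulfI (x := x - 1)); first by rewrite subr_eq0.
by rewrite -subrX1 mul0r mulr0 xN subrr.
Qed.

Section FixU.
Variable U : A.
Hypothesis UN : U ^+ N = 1.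

Lemma mul_eigproj i : U * eigproj U i = w ^+ i *: eigproj U i.
Proof.
rewrite /eigproj -scalerAr scalerA mulrC -scalerA; congr (_ *: _).
rewrite mulr_sumr scaler_sumr.
pose f (k : nat) : A := w ^+ i *: (w ^- (i * k) *: U ^+ k).
rewrite -[RHS](@sum_ord_periodic A f); last first.
  by rewrite /f UN muln0 !expr0 mulnC exprM wN expr1n.
apply: eq_bigr => k _; rewrite /f -scalerAr -exprS scalerA; congr (_ *: _).
by rewrite mulnS exprD invfM mulrA divff ?mul1r // expf_neq0.
Qed.

(** A geometric sum over roots of unity. [P] is any element with image in an eigenspace, so the
    lemma serves both for products of projectors and for single eigenvectors. *)
Lemma eigproj_mull (j : 'I_N) V (P : A) : V * P = w ^+ j *: P ->
  forall i : 'I_N, eigproj V i * P = (i == j)%:R *: P.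
Proof.
move=> VP i; have VPn n : V ^+ n * P = w ^+ (j * n) *: P.
  elim: n => [|n IH]; first by rewrite muln0 mul1r scale1r.
  by rewrite exprS -mulrA IH -scalerAr VP scalerA -exprD mulnS addnC.
rewrite /eigproj -scalerAl mulr_suml.
have -> : \sum_(k < N) w ^- (i * k) *: V ^+ k * P
          = (\sum_(k < N) (w ^+ j * w ^- i) ^+ k) *: P.
  rewrite scaler_suml; apply: eq_bigr => k _.
  rewrite -scalerAl VPn scalerA; congr (_ *: _).
  by rewrite exprMn exprVn -!exprM mulrC.
rewrite sum_root_powers; last first.
  by rewrite exprMn exprVn -!exprM ![(_ * N)%N]mulnC !exprM wN !expr1n invr1 mulr1.
rewrite scalerA mulrCA mulVf // mulr1; congr (_%:R *: _).
rewrite -(inj_eq (mulIf (expf_neq0 i w0))) mulfVK ?expf_neq0 // mul1r.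
by rewrite eq_sym (eq_prim_root_expr w_prim) !modn_small.
Qed.

Lemma eigprojM (i j : 'I_N) : eigproj U i * eigproj U j = (i == j)%:R *: eigproj U j.
Proof. exact/eigproj_mull/mul_eigproj. Qed.

Lemma sum_eigproj : \sum_(i < N) eigproj U i = 1.
Proof.
rewrite /eigproj -scaler_sumr exchange_big /=.
have N0 := prim_order_gt0 w_prim.
rewrite (bigD1 (Ordinal N0)) //= [X in _ + X]big1 ?addr0.
  under eq_bigr do rewrite muln0 invr1 scale1r.
  by rewrite sumr_const card_ord -scaler_nat scalerA mulVf // scale1r.
move=> j; rewrite -val_eqE /= => j0; rewrite -scaler_suml.
have -> : \sum_(i < N) w ^- (i * j) = \sum_(i < N) (w ^- j) ^+ i.
  by apply: eq_bigr => i _; rewrite exprVn -exprM mulnC.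
rewrite sum_root_powers; last by rewrite exprVn -exprM mulnC exprM wN expr1n invr1.
rewrite invr_eq1 -(expr0 w).
by rewrite (eq_prim_root_expr w_prim) mod0n modn_small // (negPf j0) mul0r scale0r.
Qed.

Lemma fcalc_eigproj g (i : 'I_N) : fcalc g U * eigproj U i = g i *: eigproj U i.
Proof.
rewrite mulr_suml (bigD1 i) //= -scalerAl eigprojM eqxx scale1r big1 ?addr0 //.
by move=> j /negPf ji; rewrite -scalerAl eigprojM ji scale0r scaler0.
Qed.

Lemma fcalcM g h : fcalc g U * fcalc h U = fcalc (fun i => g i * h i) U.
Proof.
rewrite {2}/fcalc mulr_sumr; apply: eq_bigr => i _.
by rewrite -scalerAr fcalc_eigproj scalerA mulrC.
Qed.

Lemma fcalc1 : fcalc (fun=> 1) U = 1.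
Proof. by rewrite -[RHS]sum_eigproj; apply: eq_bigr => i _; rewrite scale1r. Qed.

Lemma fcalc_affine (a b : F) : fcalc (fun i => a + b * w ^+ i) U = a *: 1 + b *: U.
Proof.
rewrite -[in a *: 1]sum_eigproj -[U in b *: U]mulr1 -[X in U * X]sum_eigproj.
rewrite mulr_sumr !scaler_sumr -big_split /=; apply: eq_bigr => i _.
by rewrite mul_eigproj scalerA scalerDl.
Qed.

End FixU.

(** Multiplication by [B] carries the w^i-eigenspace of [U] to the w^(i+1)-eigenspace; [g N = g 0]
    closes the cycle at the last eigenvalue. *)
Lemma fcalc_shift g U B : g N = g 0 -> U * B = w *: (B * U) ->
  fcalc g U * B = B * fcalc (fun i => g i.+1) U.
Proof.
move=> gN UB.
have PB i : eigproj U i.+1 * B = B * eigproj U i.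
  rewrite /eigproj -scalerAl -scalerAr; congr (_ *: _).
  rewrite mulr_suml mulr_sumr; apply: eq_bigr => j _.
  rewrite -scalerAl (qcommX _ UB) scalerA -scalerAr mulSn exprD invfM mulrAC.
  by rewrite mulVf ?mul1r // expf_neq0.
rewrite /fcalc mulr_sumr mulr_suml.
pose f (k : nat) : A := g k *: eigproj U k * B.
rewrite -(@sum_ord_periodic A f); last first.
  rewrite /f gN /eigproj; congr (_ *: (_ *: _) * B); apply: eq_bigr => k _.
  by rewrite mul0n exprM wN expr1n.
by apply: eq_bigr => i _; rewrite /f -scalerAl PB scalerAr.
Qed.

Lemma fcalc_comm g U B : GRing.comm U B -> GRing.comm (fcalc g U) B.
Proof.
move=> UB; apply: commr_sym; rewrite /fcalc; apply: commr_sum => i _.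
apply: commr_sym; rewrite /GRing.comm -scalerAl -scalerAr; congr (_ *: _).
rewrite /eigproj -scalerAl -scalerAr mulr_suml mulr_sumr; congr (_ *: _).
apply: eq_bigr => j _; rewrite -scalerAl -scalerAr; congr (_ *: _).
by apply: commr_sym; apply: commrX; apply: commr_sym.
Qed.

End Spectral.

(** * Operators on tensor factors *)

Section Basis.
Context (C : fieldType) (p n : nat).
Implicit Types (t s r : idx p n) (f g : Op C p n) (v : Tens C p n).

Lemma on_basis_linear (h : idx p n -> Tens C p n) :
  linear (fun v : Tens C p n => \sum_t (v t : C) *: h t).
Proof.
move=> k u v; rewrite scaler_sumr -big_split /=; apply: eq_bigr => t _.
by rewrite !ffunE scalerDl scalerA.
Qed.

Lemma on_basisE (h : idx p n -> Tens C p n) v : on_basis h v = \sum_t (v t : C) *: h t.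
Proof.
pose L := GRing.isLinear.Build C (Tens C p n) (Tens C p n) _ _ (on_basis_linear h).
pose F : {linear Tens C p n -> Tens C p n} :=
  HB.pack (fun v : Tens C p n => \sum_t (v t : C) *: h t) L.
exact: (lfunE F).
Qed.

Lemma ebasis_sum v : v = \sum_t (v t : C) *: ebasis C t.
Proof.
apply/ffunP => s; rewrite sum_ffunE (bigD1 s) //= big1 => [|t ts].
  by rewrite !ffunE eqxx addr0 /GRing.scale /= mulr1.
by rewrite !ffunE eq_sym (negPf ts) scaler0.
Qed.

Lemma on_basis_ebasis (h : idx p n -> Tens C p n) t : on_basis h (ebasis C t) = h t.
Proof.
rewrite on_basisE (bigD1 t) //= big1 => [|s st].
  by rewrite ffunE eqxx scale1r addr0.
by rewrite ffunE (negPf st) scale0r.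
Qed.

Lemma Op_ebasisP f g : (forall t, f (ebasis C t) = g (ebasis C t)) -> f = g.
Proof.
move=> fg; apply/lfunP => v; rewrite [v]ebasis_sum !linear_sum /=.
by apply: eq_bigr => t _; rewrite !linearZ /= fg.
Qed.

Definition entry f s t : C := f (ebasis C t) s.

Lemma entryP f g : entry f =2 entry g -> f = g.
Proof. by move=> fg; apply: Op_ebasisP => t; apply/ffunP => s; apply: fg. Qed.

Lemma entryM f g s t : entry (f * g) s t = \sum_r entry f s r * entry g r t.
Proof.
rewrite /entry comp_lfunE [X in f X]ebasis_sum linear_sum sum_ffunE.
by apply: eq_bigr => r _; rewrite linearZ ffunE mulrC.
Qed.

Lemma entry1 s t : entry 1 s t = (s == t)%:R.
Proof. by rewrite /entry id_lfunE ffunE. Qed.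

Lemma entryD f g s t : entry (f + g) s t = entry f s t + entry g s t.
Proof. by rewrite /entry add_lfunE ffunE. Qed.

Lemma entryZ k f s t : entry (k *: f) s t = k * entry f s t.
Proof. by rewrite /entry scale_lfunE ffunE. Qed.

Lemma entry_on_basis (h : idx p n -> Tens C p n) s t : entry (on_basis h) s t = h t s.
Proof. by rewrite /entry on_basis_ebasis. Qed.
End Basis.

(** * Calculus of operators placed on chosen tensor factors *)

Section Legs.
Context (C : fieldType) (p : nat).

Definition agree_off k n (f : 'I_k -> 'I_n) (s t : idx p n) : bool :=
  [forall i, (i \in codom f) || (s i == t i)].

Lemma agree_offP k n (f : 'I_k -> 'I_n) (s t : idx p n) :
  reflect (forall i, i \notin codom f -> s i = t i) (agree_off f s t).
Proof.
apply: (iffP forallP) => [H i fi|H i]; first by have := H i; rewrite (negPf fi) => /eqP.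
by have [//|/H->] := boolP (i \in codom f); rewrite eqxx orbT.
Qed.

Definition idx_restrict k n (f : 'I_k -> 'I_n) (t : idx p n) : idx p k := [ffun j => t (f j)].

Lemma update_codom k n (f : 'I_k -> 'I_n) t (s : idx p k) j :
  injective f -> update f t s (f j) = s j.
Proof.
move=> fI; rewrite ffunE; case: pickP => [i /eqP/fI->//|/(_ j)]; by rewrite eqxx.
Qed.

Lemma update_off k n (f : 'I_k -> 'I_n) t (s : idx p k) i :
  i \notin codom f -> update f t s i = t i.
Proof.
move=> fi; rewrite ffunE; case: pickP => [j /eqP fj|//].
by rewrite -fj codom_f in fi.
Qed.

Lemma agree_update k n (f : 'I_k -> 'I_n) t (s : idx p k) : agree_off f (update f t s) t.
Proof. by apply/agree_offP => i; apply: update_off. Qed.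

Lemma idx_restrict_update k n (f : 'I_k -> 'I_n) t (s : idx p k) :
  injective f -> idx_restrict f (update f t s) = s.
Proof. by move=> fI; apply/ffunP => j; rewrite ffunE update_codom. Qed.

Lemma update_idx_restrict k n (f : 'I_k -> 'I_n) (r t : idx p n) :
  injective f -> agree_off f r t -> update f t (idx_restrict f r) = r.
Proof.
move=> fI /agree_offP rt; apply/ffunP => i.
have [/codomP[j ->]|fi] := boolP (i \in codom f); first by rewrite update_codom // ffunE.
by rewrite update_off // rt.
Qed.

Lemma eq_update k n (f : 'I_k -> 'I_n) (r t : idx p n) s : injective f ->
  (r == update f t s) = agree_off f r t && (idx_restrict f r == s).
Proof.
move=> fI; apply/eqP/andP => [->|[rt /eqP<-]].
  by rewrite agree_update idx_restrict_update.
by rewrite update_idx_restrict.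
Qed.

(** The matrix of O tensored with the identity: a Kronecker delta off the chosen factors times the
    matrix of [O]. Most rules for [legs] below are read off from it. *)
Lemma entry_legs k n (f : 'I_k -> 'I_n) (O : Op C p k) s t : injective f ->
  entry (legs f O) s t =
  (agree_off f s t)%:R * entry O (idx_restrict f s) (idx_restrict f t).
Proof.
move=> fI; rewrite entry_on_basis sum_ffunE (bigD1 (idx_restrict f s)) //= big1 => [|r rs].
  by rewrite !ffunE eq_update // eqxx andbT addr0 mulrC.
by rewrite !ffunE eq_update // eq_sym (negPf rs) andbF scaler0.
Qed.

Lemma agree_off_transl k n (f : 'I_k -> 'I_n) (r s t : idx p n) :
  agree_off f r t -> agree_off f s r = agree_off f s t.
Proof.
move=> /agree_offP rt; apply: eq_forallb => i.
by case: (boolP (i \in _)) => //= /rt->.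
Qed.

Lemma legsM k n (f : 'I_k -> 'I_n) (O1 O2 : Op C p k) : injective f ->
  legs f (O1 * O2) = legs f O1 * legs f O2.
Proof.
move=> fI; apply: entryP => s t; rewrite entry_legs // !entryM mulr_sumr.
(* Only intermediate indices that agree with [t] off the chosen factors contribute; [update f t]
   parametrizes them by [idx p k]. *)
rewrite [RHS](bigID (fun r => agree_off f r t)) /= [X in _ + X]big1 ?addr0; last first.
  by move=> r /negPf rt; rewrite !entry_legs // rt mul0r mulr0.
rewrite (reindex_onto (update f t) (idx_restrict f)) /=; last first.
  by move=> r; apply: update_idx_restrict.
apply: eq_big => [u|u _].
  by rewrite agree_update idx_restrict_update // eqxx.
rewrite !entry_legs // idx_restrict_update // (agree_off_transl _ (agree_update _ _ _)).
by rewrite agree_update mul1r mulrA.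
Qed.

Lemma legs1 k n (f : 'I_k -> 'I_n) : injective f -> legs f 1 = 1 :> Op C p n.
Proof.
move=> fI; apply: entryP => s t; rewrite entry_legs // !entry1 -natrM mulnb.
congr (_%:R); congr nat_of_bool; apply/andP/eqP => [[st /eqP E]|->]; last first.
  by split=> //; apply/agree_offP.
by rewrite -(update_idx_restrict fI st) E update_idx_restrict //; apply/agree_offP.
Qed.

Lemma legsD k n (f : 'I_k -> 'I_n) (O1 O2 : Op C p k) : injective f ->
  legs f (O1 + O2) = legs f O1 + legs f O2.
Proof.
move=> fI; apply: entryP => s t.
by rewrite entryD !entry_legs // entryD mulrDr.
Qed.

Lemma legsZ k n (f : 'I_k -> 'I_n) (c : C) (O : Op C p k) : injective f ->
  legs f (c *: O) = c *: legs f O.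
Proof.
move=> fI; apply: entryP => s t.
by rewrite entryZ !entry_legs // entryZ mulrCA.
Qed.

Lemma legs_inj k n (f : 'I_k -> 'I_n) : injective f ->
  injective (legs f : Op C p k -> Op C p n).
Proof.
move=> fI O1 O2 E; apply: entryP => s t.
(* The entries of [O1] and [O2] are recovered by freezing all other factors at index 0. *)
pose t0 : idx p n := [ffun=> ord0].
have := congr1 (fun O => entry O (update f t0 s) (update f t0 t)) E.
rewrite !entry_legs // !idx_restrict_update // (agree_off_transl _ (agree_update _ _ _)).
by rewrite agree_update !mul1r.
Qed.

Lemma eq_legs k n (f g : 'I_k -> 'I_n) (O : Op C p k) : injective f ->
  f =1 g -> legs f O = legs g O.
Proof.
move=> fI fg; have gI : injective g by move=> i j; rewrite -!fg; apply: fI.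
apply: entryP => s t; rewrite !entry_legs //.
have restr r : idx_restrict f r = idx_restrict g r :> idx p k.
  by apply/ffunP => i; rewrite !ffunE fg.
rewrite !restr; congr (_%:R * _); congr nat_of_bool.
by apply: eq_forallb => i; rewrite (eq_codom fg).
Qed.

Lemma legs_comp m k n (g : 'I_m -> 'I_k) (f : 'I_k -> 'I_n) (O : Op C p m) :
  injective g -> injective f -> legs f (legs g O) = legs (f \o g) O.
Proof.
move=> gI fI; have fgI := inj_comp fI gI.
apply: entryP => s t; rewrite !entry_legs // mulrA -natrM mulnb.
have restr r : idx_restrict g (idx_restrict f r) = idx_restrict (f \o g) r :> idx p m.
  by apply/ffunP => i; rewrite !ffunE.
rewrite !restr; congr (_%:R * _); congr nat_of_bool.
apply/andP/agree_offP => [[/agree_offP E1 /agree_offP E2] i ifg|E].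
  have [/codomP[j ij]|] := boolP (i \in codom f); last exact: E1.
  have /E2 : j \notin codom g.
    by apply: contra ifg => /codomP[l jl]; rewrite ij jl (codom_f (f \o g)).
  by rewrite !ffunE ij.
split; apply/agree_offP => i Hi.
  by apply: E; apply: contra Hi => /codomP[l ->]; apply: codom_f.
by rewrite !ffunE; apply: E; apply: contra Hi => /codomP[l /fI->]; apply: codom_f.
Qed.

Lemma legs_comm k l n (f : 'I_k -> 'I_n) (g : 'I_l -> 'I_n)
  (O1 : Op C p k) (O2 : Op C p l) : injective f -> injective g ->
  (forall i j, f i != g j) -> legs f O1 * legs g O2 = legs g O2 * legs f O1.
Proof.
move=> fI gI fg.
have offf i : f i \notin codom g by apply/negP => /codomP[j /eqP]; apply/negP/fg.
have offg i : g i \notin codom f.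
  by apply/negP => /codomP[j /eqP]; rewrite eq_sym; apply/negP/fg.
have upC t u s : update f (update g t u) s = update g (update f t s) u :> idx p n.
  apply/ffunP => i; have [/codomP[j ->]|fi] := boolP (i \in codom f).
    by rewrite update_codom // update_off ?update_codom // offf.
  by rewrite update_off //; have [/codomP[j ->]|gi] := boolP (i \in codom g);
    rewrite ?update_codom // !update_off.
apply: Op_ebasisP => t; rewrite !comp_lfunE !on_basis_ebasis !linear_sum.
under eq_bigr => u _.
  rewrite linearZ /= on_basis_ebasis scaler_sumr.
  under eq_bigr => s _ do rewrite upC scalerA mulrC.
  over.
under [RHS]eq_bigr => s _.
  rewrite linearZ /= on_basis_ebasis scaler_sumr.
  under eq_bigr => u _ do rewrite scalerA.
  over.
rewrite exchange_big /=; apply: eq_bigr => s _; apply: eq_bigr => u _.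
congr (O1 (ebasis C _) _ * O2 (ebasis C _) _ *: _); apply/ffunP => i.
  by rewrite [LHS]ffunE [RHS]ffunE update_off.
by rewrite [LHS]ffunE [RHS]ffunE update_off.
Qed.
End Legs.

(** * The operator Phi *)

Section RootOfUnity.
Context (R : realType) (p : nat).
Local Notation C := R[i].
Local Notation N := p.+1.
Local Notation q := (q R p).

Lemma qX n :
  q ^+ n = (cos (n%:R * (pi / N%:R)) +i* sin (n%:R * (pi / N%:R)))%C.
Proof.
elim: n => [|n IH]; first by rewrite expr0 mul0r cos0 sin0.
have -> : n.+1%:R * (pi / N%:R) = pi / N%:R + n%:R * (pi / N%:R) :> R.
  by rewrite -(natr1 n) mulrDl mul1r addrC.
by rewrite exprS IH /Defs.q cosD sinD; simpc; congr (_ +i* _)%C; rewrite addrC.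
Qed.

(** With x = k pi/N and 0 < k < N, the real part of q^(2k) is cos(2x) = 1 - 2 sin(x)^2, which
    differs from 1 because 0 < x < pi. *)
Lemma q2_prim : N.-primitive_root (q ^+ 2).
Proof.
have N0 : (N%:R : R) != 0 by rewrite pnatr_eq0.
apply/andP; split => //; apply/forallP => k; rewrite unity_rootE -exprM.
have kE : (2 * k.+1)%:R * (pi / N%:R) = (k.+1%:R * (pi / N%:R)) *+ 2 :> R.
  by rewrite natrM -mulrA mulr_natl.
rewrite qX kE; apply/eqP; case: (eqVneq k.+1 N) => [->|kN].
  rewrite mulrCA divff // mulr1 cos2pi sin2pi; exact/eqP.
set x := k.+1%:R * _; have sx : 0 < sin x.
  apply: sin_gt0_pi; rewrite mulr_gt0 ?divr_gt0 ?pi_gt0 ?ltr0n //=.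
  rewrite /x mulrCA gtr_pMr ?pi_gt0 // ltr_pdivrMr ?ltr0n // mul1r ltr_nat.
  by rewrite ltn_neqAle kN ltn_ord.
apply/eqP => -[+ _].
rewrite cos_mulr2n cos2sin2 mulrnBl [1 *+ 2]mulr2n addrAC addrK => /eqP.
by rewrite -subr_eq0 addrAC subrr sub0r oppr_eq0 mulrn_eq0 /= sqrf_eq0 gt_eqF.
Qed.

Lemma natr_neq0 : (N%:R : C) != 0.
Proof. by rewrite pnatr_eq0. Qed.
End RootOfUnity.

Section PhiCalc.
Context (R : realType) (p n : nat) (zeta : R[i] -> R[i] -> R[i]).
Local Notation C := R[i].
Local Notation N := p.+1.
Local Notation q := (q R p).
Local Notation w := (q ^+ 2).
Context (U : Op C p n).
Hypothesis UN : U ^+ N = 1.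
Let w_prim := q2_prim R p.
Let N_neq0 := natr_neq0 R p.
Local Notation P i := (eigproj N w U i).

Lemma mem_eigsp (i : 'I_N) v : (v \in eigsp U i) = (U v == w ^+ i *: v).
Proof.
rewrite /eigsp memv_ker add_lfunE opp_lfunE scale_lfunE id_lfunE subr_eq0.
by rewrite exprM.
Qed.

Lemma eigproj_mem (i : 'I_N) v : P i v \in eigsp U i.
Proof.
rewrite mem_eigsp; move: (mul_eigproj w_prim UN i); move: (P i) => Q /lfunP/(_ v).
by rewrite comp_lfunE scale_lfunE => ->.
Qed.

Lemma eigproj_eigsp (i j : 'I_N) v : v \in eigsp U j -> P i v = (i == j)%:R *: v.
Proof.
rewrite mem_eigsp => /eqP Uv.
(* An operator with all basis vectors sent to [v] turns the eigenvector equation into an identity in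
   the algebra, where [eigproj_mull] applies. *)
pose V : Op C p n := on_basis (fun=> v).
have UV : U * V = w ^+ j *: V.
  by apply: Op_ebasisP => t; rewrite comp_lfunE scale_lfunE on_basis_ebasis.
move: (eigproj_mull w_prim N_neq0 UV i); move: (P i) => Q.
move=> /lfunP/(_ (ebasis C [ffun=> ord0])).
by rewrite comp_lfunE scale_lfunE on_basis_ebasis.
Qed.

(** The Fourier projector fixes the i-th eigenspace and kills the sum of the others. Hence the sum
    is direct, and the two projections agree on the decomposition of [v] given by [sum_eigproj]. *)
Lemma daddv_pi_eigsp (i : 'I_N) :
  daddv_pi (eigsp U i) (\sum_(j < N | j != i) eigsp U j)%VS = P i.
Proof.
set W := (\sum_(j < N | j != i) _)%VS.
have PW v : v \in W -> P i v = 0.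
  case/memv_sumP => f fU ->; rewrite linear_sum big1 //= => j ji.
  by rewrite (eigproj_eigsp _ (fU j ji)) eq_sym (negPf ji) scale0r.
have dis : (eigsp U i :&: W = 0)%VS.
  apply/eqP; rewrite -subv0; apply/subvP => v; rewrite memv_cap => /andP[vi vW].
  by rewrite memv0 -(PW v vW) (eigproj_eigsp _ vi) eqxx scale1r.
have piW v : v \in W -> daddv_pi (eigsp U i) W v = 0.
  move=> vW; have := daddv_pi_add dis (subvP (addvSr _ _) _ vW).
  by rewrite (daddv_pi_id _ vW) 1?capvC // => /(canRL (addrK _)); rewrite subrr.
apply/lfunP => v.
have {1}-> : v = P i v + \sum_(j < N | j != i) P j v.
  have /lfunP/(_ v) := sum_eigproj w_prim N_neq0 U.
  by rewrite sum_lfunE id_lfunE (bigD1 i).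
rewrite linearD /= (daddv_pi_id dis) ?eigproj_mem // piW ?addr0 //.
by rewrite /W memv_sumr // => j _; apply: eigproj_mem.
Qed.

Lemma PhiE a c : Phi zeta a c U = fcalc N w (fun i => zeta a c * wfun p a c i) U.
Proof. by rewrite /fcalc; apply: eq_bigr => i _; rewrite daddv_pi_eigsp. Qed.

End PhiCalc.

(** * Inverses and one or two tensor factors *)

Section OpInv.
Context (C : fieldType) (p n : nat).
Implicit Types f g : Op C p n.

(** [^-1] is a total operation on linear maps; a two-sided inverse guarantees that it is the genuine
    one. *)
Lemma inv_lfunE f g : f * g = 1 -> g * f = 1 -> (f^-1)%VF = g.
Proof.
move=> fg gf; have kf : lker f == 0%VS.
  by apply/lker0P/(can_inj (g := g)) => v; rewrite -comp_lfunE [(_ \o _)%VF]gf id_lfunE.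
by rewrite -[LHS]comp_lfun1r -[\1%VF]fg comp_lfunA (lker0_compVf kf) comp_lfun1l.
Qed.

Lemma invertible_inv f : invertible f ->
  exists2 g : Op C p n, (f^-1)%VF = g & f * g = 1 /\ g * f = 1.
Proof. by case=> g [gf fg]; exists g; [apply: inv_lfunE|]. Qed.

Lemma powopE f m : powop f m = f ^+ m.
Proof. by elim: m => [|m IH]; rewrite ?expr0 ?exprS -?IH. Qed.

Lemma invertibleM f g : invertible f -> invertible g -> invertible (f * g).
Proof.
case=> [f' [f'f ff']] [g' [g'g gg']]; rewrite !mulOpE in f'f ff' g'g gg'.
exists (g' * f'); rewrite !mulOpE; split.
  by rewrite mulrA -[_ * _ * f]mulrA f'f mulr1.
by rewrite mulrA -[_ * _ * g']mulrA gg' mulr1.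
Qed.

Lemma invertibleX f m : invertible f -> invertible (f ^+ m).
Proof.
move=> If; elim: m => [|m IH]; last by rewrite exprS; apply: invertibleM.
by exists 1; rewrite mulOpE mulr1.
Qed.
End OpInv.

Lemma invertible_legs (C : fieldType) p k n (f : 'I_k -> 'I_n) (O : Op C p k) :
  injective f -> invertible O -> invertible (legs f O).
Proof.
move=> fI [O' [E1 E2]]; exists (legs f O').
by rewrite !mulOpE -!legsM // -!mulOpE E1 E2 legs1.
Qed.

Section Single.
Context (C : fieldType) (p n : nat).
Implicit Types (i j : 'I_n).

(** [leg1] and [leg2] are forms of [at1] and [at2] whose factors are ordinals, hence counted from
    0. *)
Definition leg1 j : Op C p 1 -> Op C p n := legs (fun=> j).
Definition pair_fun i j : 'I_2 -> 'I_n := fun k => if k == ord0 then i else j.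
Definition leg2 i j : Op C p 2 -> Op C p n := legs (pair_fun i j).

Lemma cst1_inj j : injective (fun _ : 'I_1 => j).
Proof. by move=> a b _; rewrite !ord1. Qed.

Lemma pair_fun_inj i j : i != j -> injective (pair_fun i j).
Proof.
move=> ij a b; rewrite /pair_fun.
case: (unliftP ord0 a) => [a' ->|->]; case: (unliftP ord0 b) => [b' ->|->] //=.
- by rewrite !ord1.
- by move/eqP; rewrite eq_sym (negPf ij).
- by move/eqP; rewrite (negPf ij).
Qed.

Lemma leg1M j O1 O2 : leg1 j (O1 * O2) = leg1 j O1 * leg1 j O2.
Proof. exact/legsM/cst1_inj. Qed.

Lemma leg1_1 j : leg1 j 1 = 1.
Proof. exact/legs1/cst1_inj. Qed.

Lemma leg1Z j c O : leg1 j (c *: O) = c *: leg1 j O.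
Proof. exact/legsZ/cst1_inj. Qed.

Lemma leg1X j O m : leg1 j (O ^+ m) = leg1 j O ^+ m.
Proof. by elim: m => [|m IH]; rewrite ?leg1_1 // !exprS leg1M IH. Qed.

Lemma leg1_comm i j O1 O2 : i != j -> leg1 i O1 * leg1 j O2 = leg1 j O2 * leg1 i O1.
Proof. by move=> ij; apply: legs_comm => //; apply: cst1_inj. Qed.

Lemma leg1_leg2_comm i j k O1 O2 : i != j -> k != i -> k != j ->
  leg1 k O1 * leg2 i j O2 = leg2 i j O2 * leg1 k O1.
Proof.
move=> ij ki kj; apply: legs_comm => [||_ b]; first exact: cst1_inj.
  exact: pair_fun_inj.
by rewrite /pair_fun; case: ifP.
Qed.

Lemma leg2_comm i j k l O1 O2 : i != j -> k != l ->
  i != k -> i != l -> j != k -> j != l ->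
  leg2 i j O1 * leg2 k l O2 = leg2 k l O2 * leg2 i j O1.
Proof.
move=> ij kl ik il jk jl; apply: legs_comm => [||a b]; try exact: pair_fun_inj.
by rewrite /pair_fun; do 2!case: ifP.
Qed.

Lemma leg2M i j O1 O2 : i != j -> leg2 i j (O1 * O2) = leg2 i j O1 * leg2 i j O2.
Proof. by move=> ij; apply/legsM/pair_fun_inj. Qed.

Lemma legs_leg1 m (f : 'I_n -> 'I_m) j O : injective f ->
  legs f (leg1 j O) = legs (fun=> f j) O.
Proof. by move=> fI; rewrite /leg1 legs_comp //; apply: cst1_inj. Qed.

Lemma legs_leg2 m (f : 'I_n -> 'I_m) i j O : injective f -> i != j ->
  legs f (leg2 i j O) = legs (fun k => if k == ord0 then f i else f j) O.
Proof.
move=> fI ij; have gI := pair_fun_inj ij; rewrite /leg2 legs_comp //.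
apply: eq_legs; first exact: inj_comp fI gI.
by move=> k; rewrite /= /pair_fun; case: ifP.
Qed.
End Single.

Lemma OpZ (C : fieldType) p n (f : Op C p n) c v : f (c *: v) = c *: f v.
Proof. exact: linearZ. Qed.

Lemma OpM (C : fieldType) p n (f g : Op C p n) v : (f * g) v = f (g v).
Proof. exact: comp_lfunE. Qed.

Lemma OpZl (C : fieldType) p n c (f : Op C p n) v : (c *: f) v = c *: f v.
Proof. exact: scale_lfunE. Qed.

Lemma Op1 (C : fieldType) p n v : (1 : Op C p n) v = v.
Proof. exact: id_lfunE. Qed.

(** * The matrices A and B at one factor, and their commutant *)

Section Generators.
Context (C : fieldType) (p : nat) (w : C).
Local Notation N := p.+1.
Context (A B : Op C p 1).
Hypotheses (w_prim : N.-primitive_root w)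
  (A_ebasis : forall t, A (ebasis C t) = w ^+ t ord0 *: ebasis C t)
  (B_ebasis : forall t, B (ebasis C t) = ebasis C [ffun k => ordS (t k)]).

Let w_N : w ^+ N = 1.
Proof. exact: prim_expr_order w_prim. Qed.

Lemma w_ordS (k : 'I_N) : w ^+ ordS k = w * w ^+ k.
Proof. by rewrite /= (prim_expr_mod w_prim) exprS. Qed.

Lemma mulAB : A * B = w *: (B * A).
Proof.
apply: Op_ebasisP => t.
rewrite [LHS]OpM [RHS]OpZl [in RHS]OpM B_ebasis !A_ebasis.
by rewrite OpZ B_ebasis scalerA ffunE w_ordS.
Qed.

Lemma A_N : A ^+ N = 1.
Proof.
apply: Op_ebasisP => t.
have AX k : (A ^+ k) (ebasis C t) = w ^+ (t ord0 * k) *: ebasis C t.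
  elim: k => [|k IH]; first by rewrite muln0 scale1r expr0 Op1.
  by rewrite exprS OpM IH OpZ A_ebasis scalerA -exprD mulnS addnC.
by rewrite AX mulnC exprM w_N expr1n scale1r Op1.
Qed.

Lemma iter_ordS k (i : 'I_N) : iter k (@ordS N) i = ((i + k) %% N)%N :> nat.
Proof.
elim: k => [|k IH]; first by rewrite addn0 modn_small.
by rewrite iterS /= IH -addn1 modnDml -addnA addn1.
Qed.

Lemma B_N : B ^+ N = 1.
Proof.
apply: Op_ebasisP => t.
have BX k : (B ^+ k) (ebasis C t) = ebasis C [ffun i => iter k (@ordS N) (t i)].
  elim: k => [|k IH].
    by rewrite expr0 Op1; congr (ebasis C _); apply/ffunP => i; rewrite ffunE.
  rewrite exprS OpM IH B_ebasis; congr (ebasis C _).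
  by apply/ffunP => i; rewrite !ffunE.
rewrite BX Op1; congr (ebasis C _); apply/ffunP => i; rewrite ffunE.
by apply: ord_inj; rewrite iter_ordS modnDr modn_small.
Qed.

Section Site.
Context (n : nat).
Implicit Types (i j : 'I_n).

Lemma update1 j (t : idx p n) (s : idx p 1) :
  update (fun=> j) t s = [ffun i => if i == j then s ord0 else t i].
Proof.
apply/ffunP => i; rewrite !ffunE; case: pickP => [k /eqP->|/(_ ord0)].
  by rewrite eqxx ord1.
by rewrite eq_sym => ->.
Qed.

Lemma siteA_ebasis j t : leg1 j A (ebasis C t) = w ^+ t j *: ebasis C t.
Proof.
have jI := @cst1_inj _ j; apply/ffunP => s; rewrite -[LHS]/(entry _ s t).
rewrite entry_legs // /entry A_ebasis !ffunE mulrCA -natrM mulnb; congr (_ * _).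
rewrite -eq_update // update1; congr (s == _)%:R.
by apply/ffunP => i; rewrite !ffunE; case: eqP => [->|].
Qed.

Lemma siteB_ebasis j t :
  leg1 j B (ebasis C t) = ebasis C [ffun i => if i == j then ordS (t i) else t i].
Proof.
have jI := @cst1_inj _ j; apply/ffunP => s; rewrite -[LHS]/(entry _ s t).
rewrite entry_legs // /entry B_ebasis !ffunE -natrM mulnb.
rewrite -eq_update // update1; congr (s == _)%:R.
by apply/ffunP => i; rewrite !ffunE; case: eqP => [->|].
Qed.

Lemma siteAB j : leg1 j A * leg1 j B = w *: (leg1 j B * leg1 j A).
Proof. by rewrite -!leg1M mulAB leg1Z. Qed.

Lemma siteA_N j : leg1 j A ^+ N = 1.
Proof. by rewrite -leg1X A_N leg1_1. Qed.

Lemma siteB_N j : leg1 j B ^+ N = 1.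
Proof. by rewrite -leg1X B_N leg1_1. Qed.

(* A_j and B_j generate the full matrix algebra of the factor j. *)
Lemma commutant_site k (f : 'I_k -> 'I_n) j (O : Op C p n) : injective f ->
  (forall i, (i \in codom f) = (i != j)) ->
  O * leg1 j A = leg1 j A * O -> O * leg1 j B = leg1 j B * O ->
  exists T, O = legs f T.
Proof.
move=> fI fj OA OB.
(* Commuting with the diagonal A_j forces w^(s_j) = w^(t_j) at every nonzero entry. *)
have diag (s t : idx p n) : s j != t j -> entry O s t = 0.
  move=> st; have := congr1 (fun P : Op C p n => entry P s t) OA.
  rewrite {1}/entry OpM siteA_ebasis OpZ ffunE -/(entry _ _ _).
  rewrite entryM (bigD1 s) //= big1 ?addr0 => [|r rs]; last first.
    by rewrite /entry siteA_ebasis !ffunE eq_sym (negPf rs) scaler0 mul0r.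
  rewrite /entry siteA_ebasis !ffunE eqxx [_ *: 1]mulr1 => /eqP.
  rewrite -subr_eq0 -[_ *: _]/(_ * _) -mulrBl mulf_eq0 subr_eq0.
  rewrite (eq_prim_root_expr w_prim) !modn_small // => /orP[|/eqP//].
  by rewrite eq_sym => /eqP/val_inj/eqP; rewrite (negPf st).
pose S (t : idx p n) : idx p n := [ffun i => if i == j then ordS (t i) else t i].
have shift (s t : idx p n) : entry O (S s) (S t) = entry O s t.
  have := congr1 (fun P : Op C p n => entry P (S s) t) OB.
  rewrite {1}/entry OpM siteB_ebasis -/(entry _ _ _) => ->.
  rewrite entryM (bigD1 s) //= big1 ?addr0 => [|r rs]; last first.
    rewrite /entry siteB_ebasis !ffunE [_ == _](_ : _ = false) ?mul0r //.
    apply: contraNF rs => /eqP/ffunP E; apply/eqP/ffunP => i.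
    have := E i; rewrite !ffunE; case: eqP => // _.
    by move/ordS_inj.
  by rewrite /entry siteB_ebasis ffunE eqxx mul1r.
pose Z (t : idx p n) := update f [ffun=> ord0] (idx_restrict f t) : idx p n.
have ZE t i : Z t i = if i == j then ord0 else t i.
  case: eqP => [->|/eqP ij]; first by rewrite update_off ?ffunE // fj eqxx.
  have /codomP[l ->] : i \in codom f by rewrite fj.
  by rewrite update_codom // ffunE.
(* Entries are invariant under simultaneous shifts of the j-th coordinates, so N - s_j shifts bring
   both of them to 0. *)
have red (s t : idx p n) : s j = t j -> entry O s t = entry O (Z s) (Z t).
  move=> st; pose It m (t : idx p n) : idx p n :=
    [ffun i => if i == j then iter m (@ordS N) (t i) else t i].
  have shiftm m : entry O (It m s) (It m t) = entry O s t.
    elim: m => [|m IH].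
      by congr (entry O _ _); apply/ffunP => i; rewrite !ffunE; case: eqP.
    rewrite -[RHS]IH -[RHS]shift; congr (entry O _ _); apply/ffunP => i;
      by rewrite !ffunE; case: eqP.
  rewrite -(shiftm (N - s j)%N); congr (entry O _ _); apply/ffunP => i;
    rewrite ffunE ZE; case: eqP => // ->; apply: ord_inj; rewrite iter_ordS /= -?st.
    by rewrite subnKC ?modnn // ltnW.
  by rewrite subnKC ?modnn // ltnW.
(* The matrix of [T] is the block of [O] in which the j-th coordinate is 0. *)
exists (on_basis (fun t => \sum_s
  entry O (update f [ffun=> ord0] s) (update f [ffun=> ord0] t) *: ebasis C s)).
apply: entryP => s t; rewrite entry_legs // entry_on_basis sum_ffunE.
rewrite (bigD1 (idx_restrict f s)) //= big1 ?addr0 => [|r rs]; last first.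
  by rewrite !ffunE eq_sym (negPf rs) scaler0.
rewrite !ffunE eqxx [_ *: 1]mulr1 -/(Z s) -/(Z t).
have -> : agree_off f s t = (s j == t j).
  apply/agree_offP/eqP => [|st i]; first by apply; rewrite fj eqxx.
  by rewrite fj negbK => /eqP->.
by case: eqVneq => [/red->|/diag->]; rewrite ?mul1r ?mul0r.
Qed.
End Site.
End Generators.

(** * The intertwiner F *)

Section TwoSites.
Context (C : fieldType) (p : nat) (w : C).
Local Notation N := p.+1.
Context (A B : Op C p 1) (S Bi : Op C p 2).
Hypotheses (oddN : odd N) (N_neq0 : N%:R != 0 :> C)
  (w_prim : N.-primitive_root w)
  (A_ebasis : forall t, A (ebasis C t) = w ^+ t ord0 *: ebasis C t)
  (B_ebasis : forall t, B (ebasis C t) = ebasis C [ffun k => ordS (t k)])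
  (S_ebasis : forall t, S (ebasis C t) = ebasis C
     [ffun k : 'I_2 => if k == ord0 then t ord0 else t ord0 + t ord_max]).
Local Notation a1 := (leg1 (ord0 : 'I_2) A).
Local Notation a2 := (leg1 (ord_max : 'I_2) A).
Local Notation b1 := (leg1 (ord0 : 'I_2) B).
Local Notation b2 := (leg1 (ord_max : 'I_2) B).
Hypotheses (b2Bi : b2 * Bi = 1) (Bib2 : Bi * b2 = 1).
Let U := b1 * a2 * Bi.

Let w_N : w ^+ N = 1.
Proof. exact: prim_expr_order w_prim. Qed.
Let o01 : (ord0 : 'I_2) != ord_max. Proof. by []. Qed.
Let o10 : (ord_max : 'I_2) != ord0. Proof. by []. Qed.
Let ab2 : a2 * b2 = w *: (b2 * a2). Proof. exact (siteAB w_prim A_ebasis B_ebasis _). Qed.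
Let ab1 : a1 * b1 = w *: (b1 * a1). Proof. exact (siteAB w_prim A_ebasis B_ebasis _). Qed.

Lemma Bi_a2 : Bi * a2 = w *: (a2 * Bi).
Proof.
rewrite -[LHS]mulr1 -b2Bi -!mulrA [a2 * _]mulrA ab2 -scalerAl -scalerAr.
by rewrite -mulrA [Bi * _]mulrA Bib2 mul1r.
Qed.

Lemma b1_Bi : b1 * Bi = Bi * b1.
Proof.
rewrite -[LHS]mul1r -{1}Bib2 -!mulrA; congr (_ * _).
by rewrite mulrA (leg1_comm _ _ o10) -mulrA b2Bi mulr1.
Qed.

Lemma a1_Bi : a1 * Bi = Bi * a1.
Proof.
rewrite -[LHS]mul1r -{1}Bib2 -!mulrA; congr (_ * _).
by rewrite mulrA (leg1_comm _ _ o10) -mulrA b2Bi mulr1.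
Qed.

Lemma Bi_N : Bi ^+ N = 1.
Proof.
have Bb k : Bi ^+ k * b2 ^+ k = 1.
  elim: k => [|k IH]; first by rewrite !expr0 mulr1.
  by rewrite exprSr exprS mulrA -[_ * Bi * _]mulrA Bib2 mulr1.
by rewrite -[RHS](Bb N) (siteB_N B_ebasis) mulr1.
Qed.

(** b1 commutes with a2 and with [Bi], while (a2 Bi)^N differs from a2^N Bi^N by w^(N(N-1)/2), which
    is 1 for odd [N]. *)
Lemma U_N : U ^+ N = 1.
Proof.
rewrite /U -mulrA exprMn_comm; last first.
  apply: commrM; first exact: leg1_comm.
  exact: b1_Bi.
rewrite (exprM_qcomm _ Bi_a2) (expr_bin2_odd oddN) // scale1r Bi_N.
by rewrite (siteA_N w_prim A_ebasis) (siteB_N B_ebasis) !mulr1.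
Qed.

Lemma U_b2 : U * b2 = b1 * a2.
Proof. by rewrite /U -mulrA Bib2 mulr1. Qed.

Lemma U_qcomm_b2 : U * b2 = w *: (b2 * U).
Proof.
rewrite U_b2 /U !mulrA (leg1_comm _ _ o10) -[b1 * b2 * a2]mulrA.
by rewrite scalerAl scalerAr -ab2 -!mulrA b2Bi mulr1.
Qed.

(** The scalar from moving a1 past b1 cancels the one from moving a2 past the inverse of b2. *)
Lemma U_comm_a12 : GRing.comm U (a1 * a2).
Proof.
have E : Bi * (a1 * a2) = w *: (a1 * (a2 * Bi)).
  by rewrite mulrA -a1_Bi -mulrA Bi_a2 -scalerAr.
rewrite /GRing.comm /U -!mulrA E -!scalerAr [a2 * (a1 * _)]mulrA.
rewrite (leg1_comm _ _ o10) [a2 * (b1 * _)]mulrA (leg1_comm A B o10).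
by rewrite -!mulrA [a1 * (b1 * _)]mulrA ab1 -scalerAl -mulrA.
Qed.

Lemma S_a12 : S * (a1 * a2) = a2 * S.
Proof.
apply: Op_ebasisP => t; rewrite !OpM S_ebasis !(siteA_ebasis A_ebasis).
rewrite !OpZ (siteA_ebasis A_ebasis) OpZ S_ebasis scalerA -exprD.
by rewrite ffunE /= (prim_expr_mod w_prim) addnC.
Qed.

Lemma S_b2 : S * b2 = b2 * S.
Proof.
apply: Op_ebasisP => t; rewrite !OpM S_ebasis !(siteB_ebasis B_ebasis).
rewrite S_ebasis; congr (ebasis C _); apply/ffunP => k; rewrite !ffunE /=.
case: (unliftP ord0 k) => [k' ->|->] //=; rewrite ord1 /=.
by apply: val_inj; rewrite /= modnDmr addnS -addn1 -[in RHS]addn1 modnDml.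
Qed.

Lemma S_invertible : invertible S.
Proof.
exists (on_basis (fun t => ebasis C
  [ffun k : 'I_2 => if k == ord0 then t ord0 else t ord_max - t ord0])).
split; apply: Op_ebasisP => t; rewrite Op1 OpM ?on_basis_ebasis S_ebasis ?on_basis_ebasis;
  congr (ebasis C _); apply/ffunP => k; rewrite !ffunE /=;
  case: (unliftP ord0 k) => [k' ->|->] //=; rewrite ord1 /=.
- by rewrite addrAC subrr add0r; congr (t _); apply: ord_inj.
- by rewrite addrC subrK; congr (t _); apply: ord_inj.
Qed.

Section F.
Context (m : nat) (a c : C) (g : nat -> C).
Hypotheses (gS : forall i, g i.+1 * (c - a * w ^+ i.+1) = g i) (gN : g N = g 0)
  (g_neq0 : forall i, g i != 0).

(** The shape of [opF], with [m] for m_{x,x'} and [g] for the weight function w(a,c|.) scaled by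
    [zeta]; see [opFE]. *)
Let F := Bi ^+ m * S * fcalc N w g U.

Lemma intertwiner_invertible : invertible F.
Proof.
apply: invertibleM; first apply: invertibleM.
- by apply: invertibleX; exists b2; rewrite !mulOpE.
- exact: S_invertible.
(* Since [g] does not vanish, its pointwise inverse inverts the functional calculus. *)
exists (fcalc N w (fun i => (g i)^-1) U : Op C p 2).
have E : fcalc N w (fun=> 1) U = 1 :> Op C p 2 by apply: fcalc1.
split; rewrite mulOpE (fcalcM w_prim N_neq0 U_N) -[RHS]E; apply: eq_bigr => i _.
  by rewrite mulVf.
by rewrite divff.
Qed.

(** Moving the [m] copies of [Bi] past a2 yields w^m, exactly the discrepancy between the root of x
    x' and the product of the roots. *)
Lemma intertwiner_X : F * (a1 * a2) = w ^+ m *: (a2 * F).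
Proof.
rewrite /F -mulrA (fcalc_comm _ _ _ U_comm_a12) [LHS]mulrA -[_ * S * _]mulrA S_a12.
by rewrite mulrA (qcommX _ Bi_a2) -!scalerAl -!mulrA.
Qed.

(* The difference equation of the weight g is the functional equation
   Phi(U) (c - a U) = Phi(w^-1 U) of the cyclic quantum dilogarithm. *)
Lemma intertwiner_Y : F * (c *: b2 - a *: (b1 * a2)) = b2 * F.
Proof.
(* Because U b2 = b1 a2, the action of Y is (c - aU) b2 up to normalization, so the functional
   calculus of [U] applies. *)
have -> : c *: b2 - a *: (b1 * a2) = fcalc N w (fun i => c + - a * w ^+ i) U * b2.
  rewrite (fcalc_affine w_prim N_neq0 U_N) scaleNr mulrBl -!scalerAl mul1r.
  by rewrite U_b2.
rewrite /F -mulrA [fcalc N w g U * _]mulrA (fcalcM w_prim N_neq0 U_N).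
rewrite (fcalc_shift w_prim _ U_qcomm_b2); last by rewrite gN w_N expr0.
have -> : fcalc N w (fun i => g i.+1 * (c + - a * w ^+ i.+1)) U = fcalc N w g U.
  by rewrite /fcalc; apply: eq_bigr => i _; rewrite mulNr gS.
rewrite !mulrA -[_ * S * b2]mulrA S_b2 mulrA; congr (_ * _ * _).
have: GRing.comm b2 Bi by rewrite /GRing.comm b2Bi Bib2.
by move/commrX => ->.
Qed.
End F.
End TwoSites.

(** * The operator T and the pentagon *)

Section ThreeSites.
Context (C : fieldType) (p n : nat).
Implicit Types (a b c : 'I_n) (O : Op C p 2).

Definition triple_fun a b c : 'I_3 -> 'I_n := fun k => tnth [tuple a; b; c] k.

Lemma triple_fun_inj a b c : a != b -> a != c -> b != c ->
  injective (triple_fun a b c).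
Proof.
move=> ab ac bc; apply/tuple_uniqP; rewrite /= !inE negb_or ab ac bc //.
Qed.

Local Notation i1 := (inord 0 : 'I_3).
Local Notation i2 := (inord 1 : 'I_3).
Local Notation i3 := (inord 2 : 'I_3).

Lemma triple_fun1 a b c : triple_fun a b c i1 = a.
Proof. by rewrite /triple_fun (tnth_nth a) inordK. Qed.
Lemma triple_fun2 a b c : triple_fun a b c i2 = b.
Proof. by rewrite /triple_fun (tnth_nth a) inordK. Qed.
Lemma triple_fun3 a b c : triple_fun a b c i3 = c.
Proof. by rewrite /triple_fun (tnth_nth a) inordK. Qed.
End ThreeSites.

Lemma inord_neq n i j : (i <= n)%N -> (j <= n)%N -> i != j ->
  inord i != inord j :> 'I_n.+1.
Proof. by move=> ltin ltjn; rewrite -val_eqE /= !inordK. Qed.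

Lemma at2E (C : fieldType) p n (i j : nat) (O : Op C p 2) :
  (i.-1 <= n)%N -> (j.-1 <= n)%N -> i.-1 != j.-1 ->
  at2 i j O = leg2 (inord i.-1 : 'I_n.+1) (inord j.-1) O.
Proof.
move=> ltin ltjn ij; apply/esym/eq_legs => [|k]; last by rewrite /pair_fun; case: ifP.
exact/pair_fun_inj/inord_neq.
Qed.

Lemma legs_leg2E (C : fieldType) p n m (f : 'I_n -> 'I_m) i j (O : Op C p 2) :
  injective f -> i != j -> legs f (leg2 i j O) = leg2 (f i) (f j) O.
Proof.
by move=> fI ij; rewrite legs_leg2.
Qed.

Lemma leg2_leg1 (C : fieldType) p n (i j : 'I_n) (O : Op C p 1) : i != j ->
  leg2 i j (leg1 ord0 O) = leg1 i O.
Proof. by move=> ij; rewrite /leg2 legs_leg1 //; apply: pair_fun_inj. Qed.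

Lemma leg2_leg1_max (C : fieldType) p n (i j : 'I_n) (O : Op C p 1) : i != j ->
  leg2 i j (leg1 ord_max O) = leg1 j O.
Proof. by move=> ij; rewrite /leg2 legs_leg1 //; apply: pair_fun_inj. Qed.

Lemma invertible_leg2 (C : fieldType) p n (i j : 'I_n) (O : Op C p 2) : i != j ->
  invertible O -> invertible (leg2 i j O).
Proof. by move/pair_fun_inj/invertible_legs; apply. Qed.

Lemma leg2_1 (C : fieldType) p n (i j : 'I_n) : i != j -> leg2 i j 1 = 1 :> Op C p n.
Proof. by move/pair_fun_inj/legs1. Qed.

Lemma leg2_inj (C : fieldType) p n (i j : 'I_n) : i != j ->
  injective (leg2 i j : Op C p 2 -> Op C p n).
Proof. by move/pair_fun_inj/legs_inj. Qed.

Lemma commutant_leg2 (C : fieldType) (p : nat) (w : C) (A B : Op C p 1) n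
    (i j k : 'I_n) (O : Op C p n) :
  p.+1.-primitive_root w ->
  (forall t, A (ebasis C t) = w ^+ t ord0 *: ebasis C t) ->
  (forall t, B (ebasis C t) = ebasis C [ffun k => ordS (t k)]) ->
  i != j -> (forall l, (l \in codom (pair_fun i j)) = (l != k)) ->
  O * leg1 k A = leg1 k A * O -> O * leg1 k B = leg1 k B * O ->
  exists T, O = leg2 i j T.
Proof. by move=> wP AE BE /pair_fun_inj; apply: (commutant_site wP AE BE). Qed.

Section Pentagon.
(* Otherwise failing unifications unfold operators down to matrices. *)
Local Opaque legs on_basis leg1 leg2.
Context (C : fieldType) (p : nat).
Implicit Types (F T : Op C p 2).

Lemma mul3_morph (A A' : pzRingType) (h : A -> A') (t f4 f3 f1 f2 : A) :
  {morph h : x y / x * y} -> t * (f4 * f3) = f1 * f2 ->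
  h t * (h f4 * h f3) = h f1 * h f2.
Proof. by move=> hM E; rewrite -!hM E. Qed.

Lemma mul_add_morph (A A' : pzRingType) (h : A -> A') (f x y u v : A) :
  {morph h : x y / x * y} -> {morph h : x y / x + y} ->
  f * (x * y + u) = v * f -> h f * (h x * h y + h u) = h v * h f.
Proof. by move=> hM hD E; rewrite -!hM -hD -hM E hM. Qed.

(* The equation F_13 F_23 F_12^-1 F_23^-1 = T_21 on the factors a, b, c, cleared
   of inverses *)
Definition Tspec T F_l_l'l'' F_l'_l'' F_l_l' F_ll'_l'' n (a b c : 'I_n) :=
  leg2 b a T * (leg2 b c F_ll'_l'' * leg2 a b F_l_l') =
  leg2 a c F_l_l'l'' * leg2 b c F_l'_l''.

(** [legs] along the three chosen factors is multiplicative and sends each two-factor operator to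
    its counterpart, so an identity on three factors can be reused inside four. *)
Lemma Tspec_transport T F1 F2 F3 F4 n (a b c : 'I_n) :
  a != b -> a != c -> b != c ->
  Tspec T F1 F2 F3 F4 (inord 0 : 'I_3) (inord 1) (inord 2) ->
  Tspec T F1 F2 F3 F4 a b c.
Proof.
move=> ab ac bc E; have fI := triple_fun_inj ab ac bc.
pose h : Op C p 3 -> Op C p n := legs (triple_fun a b c).
have hM O1 O2 : h (O1 * O2) = h O1 * h O2 by apply: legsM.
have hL i j a' b' : i != j -> triple_fun a b c i = a' -> triple_fun a b c j = b' ->
    forall O, leg2 a' b' O = h (leg2 i j O).
  by move=> ij <- <- O; rewrite -legs_leg2E.
have h12 := hL _ _ _ _ (@inord_neq 2 0 1 isT isT isT) (triple_fun1 a b c) (triple_fun2 a b c).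
have h21 := hL _ _ _ _ (@inord_neq 2 1 0 isT isT isT) (triple_fun2 a b c) (triple_fun1 a b c).
have h13 := hL _ _ _ _ (@inord_neq 2 0 2 isT isT isT) (triple_fun1 a b c) (triple_fun3 a b c).
have h23 := hL _ _ _ _ (@inord_neq 2 1 2 isT isT isT) (triple_fun2 a b c) (triple_fun3 a b c).
clearbody h.
rewrite /Tspec (h21 T) (h23 F4) (h12 F3) (h13 F1) (h23 F2).
exact: (mul3_morph hM E).
Qed.

Lemma invertible_mulIr n (f g h : Op C p n) : invertible h -> f * h = g * h -> f = g.
Proof.
move=> /invertible_inv[h' _ [hh' _]] E.
by rewrite -[f]mulr1 -[g]mulr1 -hh' !mulrA E.
Qed.

(* The digits name the weights of the quadruple (e.g. F0_12 is F for the pair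
   l, l' ** l''), the letters the factors acted on.  After multiplication by the
   invertible product of the F's that leads from V_0 (x) V_1 (x) V_2 (x) V_3 to
   the source of the pentagon, both sides become ad_F0_123 bd_F1_23 cd_F23. *)
Lemma pentagon_ring (A : pzRingType)
    (ab_F01 bc_F12 cd_F23 ac_F0_12 bc_F01_2 bd_F1_23 cd_F12_3 bd_F01_23 ad_F0_123 cd_F012_3
     ba_T0_1_23 cb_T01_2_3 cb_T1_2_3 ca_T0_12_3 ba_T0_1_2 : A) :
  ba_T0_1_23 * (bd_F01_23 * ab_F01) = ad_F0_123 * bd_F1_23 ->
  cb_T01_2_3 * (cd_F012_3 * bc_F01_2) = bd_F01_23 * cd_F23 ->
  cb_T1_2_3 * (cd_F12_3 * bc_F12) = bd_F1_23 * cd_F23 ->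
  ca_T0_12_3 * (cd_F012_3 * ac_F0_12) = ad_F0_123 * cd_F12_3 ->
  ba_T0_1_2 * (bc_F01_2 * ab_F01) = ac_F0_12 * bc_F12 ->
  cd_F23 * ab_F01 = ab_F01 * cd_F23 ->
  ba_T0_1_2 * cd_F012_3 = cd_F012_3 * ba_T0_1_2 ->
  cb_T1_2_3 * ad_F0_123 = ad_F0_123 * cb_T1_2_3 ->
  ba_T0_1_23 * cb_T01_2_3 * (cd_F012_3 * (bc_F01_2 * ab_F01)) =
  cb_T1_2_3 * ca_T0_12_3 * ba_T0_1_2 * (cd_F012_3 * (bc_F01_2 * ab_F01)).
Proof.
move=> E1 E2 E3 E4 E5 FF TF TF'.
transitivity (ad_F0_123 * (bd_F1_23 * cd_F23)).
  rewrite -mulrA [cd_F012_3 * _]mulrA [cb_T01_2_3 * _]mulrA E2.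
  by rewrite -mulrA FF [bd_F01_23 * _]mulrA [LHS]mulrA E1 mulrA.
(* The T on b, a passes the F on c, d, so [E5] and then [E4] apply; the remaining T on c, b passes
   the F on a, d, and [E3] finishes. *)
rewrite -!mulrA [ba_T0_1_2 * _]mulrA TF -mulrA E5 [cd_F012_3 * _]mulrA.
rewrite [ca_T0_12_3 * _]mulrA E4 -mulrA [RHS]mulrA TF' -mulrA; congr (_ * _).
by rewrite E3.
Qed.

Lemma pentagon_of_Tspec F01 F12 F23 F0_12 F01_2 F1_23 F12_3 F01_23 F0_123 F012_3
    T0_1_23 T01_2_3 T1_2_3 T0_12_3 T0_1_2 n (a b c d : 'I_n) :
  uniq [:: a; b; c; d] ->
  invertible F01 -> invertible F01_2 -> invertible F012_3 ->
  (forall x y z : 'I_n, x != y -> x != z -> y != z ->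
     [/\ Tspec T0_1_23 F0_123 F1_23 F01 F01_23 x y z,
         Tspec T01_2_3 F01_23 F23 F01_2 F012_3 x y z,
         Tspec T1_2_3 F1_23 F23 F12 F12_3 x y z,
         Tspec T0_12_3 F0_123 F12_3 F0_12 F012_3 x y z
       & Tspec T0_1_2 F0_12 F12 F01 F01_2 x y z]) ->
  leg2 b a T0_1_23 * leg2 c b T01_2_3 =
  leg2 c b T1_2_3 * leg2 c a T0_12_3 * leg2 b a T0_1_2.
Proof.
rewrite /= !inE !negb_or => /and4P[/and3P[ab ac ad] /andP[bc bd] cd _].
move=> I01 I01_2 I012_3 HT.
have [ba ca da] : [/\ b != a, c != a & d != a] by rewrite ![_ == a]eq_sym.
have [cb db dc] : [/\ c != b, d != b & d != c].
  by rewrite ![_ == b]eq_sym [d == c]eq_sym.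
pose G := leg2 c d F012_3 * (leg2 b c F01_2 * leg2 a b F01).
apply: (@invertible_mulIr _ _ _ G).
  apply: invertibleM; last apply: invertibleM.
  - exact: invertible_leg2 cd I012_3.
  - exact: invertible_leg2 bc I01_2.
  - exact: invertible_leg2 ab I01.
(* Each F leaves the fused module on its second factor, which dictates the triple of factors for
   each relation: 23 sits on d, 12 on c and 01 on b. *)
have [E1 _ _ _ _] := HT a b d ab ad bd.
have [_ E2 _ _ _] := HT b c d bc bd cd.
have [_ _ E3 _ _] := HT b c d bc bd cd.
have [_ _ _ E4 _] := HT a c d ac ad cd.
have [_ _ _ _ E5] := HT a b c ab ac bc.
rewrite /Tspec in E1 E2 E3 E4 E5.
by apply: (pentagon_ring E1 E2 E3 E4 E5); apply: leg2_comm.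
Qed.
End Pentagon.

(** * The quotient of two fusions commutes with the fused action *)

Section TripleCommute.
Context (A : pzRingType) (H1 H2 G1 G2 K : A).
Hypothesis HK : H2 * H1 * K = 1.
Hypothesis KH : K * (H2 * H1) = 1.

(** [K] inverts the fusion H2 H1. Both fusions carry the unfused action [D] to the same fused action
    [Z], so going back along one and forward along the other preserves [Z]. *)
Lemma conj_commute D Z : H2 * H1 * D = Z * (H2 * H1) -> G2 * G1 * D = Z * (G2 * G1) ->
  G2 * G1 * K * Z = Z * (G2 * G1 * K).
Proof.
move=> HD GD; have KZ : K * Z = D * K.
  by rewrite -[LHS]mulr1 -HK mulrA -[K * Z * _]mulrA -HD mulrA KH mul1r.
by rewrite -[LHS]mulrA KZ [LHS]mulrA GD -[LHS]mulrA.
Qed.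

Lemma triple_commute_X X1 X2 X3 X12 X23 X123 :
  H1 * (X1 * X2) = X12 * H1 -> G1 * (X2 * X3) = X23 * G1 ->
  G2 * (X1 * X23) = X123 * G2 -> H2 * (X12 * X3) = X123 * H2 ->
  X1 * G1 = G1 * X1 -> X3 * H1 = H1 * X3 ->
  G2 * G1 * K * X123 = X123 * (G2 * G1 * K).
Proof.
move=> H1X G1X G2X H2X XG XH; apply: (@conj_commute (X1 * X2 * X3)).
  by rewrite -mulrA [H1 * _]mulrA H1X -mulrA -XH [X12 * _]mulrA mulrA H2X mulrA.
rewrite -mulrA -[X1 * X2 * X3]mulrA [G1 * _]mulrA -XG -mulrA G1X.
by rewrite [X1 * _]mulrA mulrA G2X mulrA.
Qed.

(** Coassociativity for Y: (Y1 X2 + Y2) X3 + Y3 also reads Y1 (X2 X3) + (Y2 X3 + Y3), and each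
    fusion order uses one of the two forms. *)
Lemma triple_commute_Y X2 X3 Y1 Y2 Y3 X23 Y12 Y23 Y123 :
  H1 * (Y1 * X2 + Y2) = Y12 * H1 -> G1 * (X2 * X3) = X23 * G1 ->
  G1 * (Y2 * X3 + Y3) = Y23 * G1 ->
  G2 * (Y1 * X23 + Y23) = Y123 * G2 -> H2 * (Y12 * X3 + Y3) = Y123 * H2 ->
  Y1 * G1 = G1 * Y1 -> X3 * H1 = H1 * X3 -> Y3 * H1 = H1 * Y3 ->
  G2 * G1 * K * Y123 = Y123 * (G2 * G1 * K).
Proof.
move=> H1Y G1X G1Y G2Y H2Y YG XH YH.
apply: (@conj_commute ((Y1 * X2 + Y2) * X3 + Y3)).
  rewrite -mulrA mulrDr -YH [H1 * _]mulrA H1Y -mulrA -XH [Y12 * _]mulrA -mulrDl.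
  by rewrite mulrA H2Y mulrA.
rewrite mulrDl -addrA -mulrA mulrDr G1Y -[Y1 * X2 * X3]mulrA [G1 * _]mulrA -YG.
by rewrite -mulrA G1X [Y1 * _]mulrA -mulrDl mulrA G2Y mulrA.
Qed.
Lemma quotient_inverses L : G2 * G1 * L = 1 -> L * (G2 * G1) = 1 ->
  [/\ G2 * G1 * K * (H2 * H1 * L) = 1, H2 * H1 * L * (G2 * G1 * K) = 1
    & G2 * G1 * K * (H2 * H1) = G2 * G1].
Proof.
move=> GL LG; split.
- by rewrite -[LHS]mulrA [K * _]mulrA KH mul1r.
- by rewrite -[LHS]mulrA [L * _]mulrA LG mul1r.
- by rewrite -[LHS]mulrA KH mulr1.
Qed.
End TripleCommute.

Lemma inverse_commutes (A : pzRingType) (x y z : A) :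
  x * y = 1 -> y * x = 1 -> x * z = z * x -> y * z = z * y.
Proof.
move=> xy yx xz; rewrite -[LHS]mulr1 -xy mulrA -[y * z * x]mulrA -xz.
by rewrite mulrA yx mul1r.
Qed.

Section TripleExistence.
Local Opaque legs on_basis leg1 leg2.
Context (C : fieldType) (p : nat) (w : C).
Context (A B : Op C p 1).
Hypotheses (w_prim : p.+1.-primitive_root w)
  (A_ebasis : forall t, A (ebasis C t) = w ^+ t ord0 *: ebasis C t)
  (B_ebasis : forall t, B (ebasis C t) = ebasis C [ffun k => ordS (t k)]).

(* F is a W-morphism V (x) V' -> M (x) V'' with M trivial, where X and Y act by
   xA, yB on V, by x'A, y'B on V' and by x''A, y''B on V''. *)
Definition intertwines (x y x' y' x'' y'' : C) (F : Op C p 2) :=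
  F * (leg1 ord0 (x *: A) * leg1 ord_max (x' *: A))
    = leg1 ord_max (x'' *: A) * F /\
  F * (leg1 ord0 (y *: B) * leg1 ord_max (x' *: A) + leg1 ord_max (y' *: B))
    = leg1 ord_max (y'' *: B) * F.

Lemma intertwines_leg2 x y x' y' x'' y'' F n (i j : 'I_n) : i != j ->
  intertwines x y x' y' x'' y'' F ->
  leg2 i j F * (leg1 i (x *: A) * leg1 j (x' *: A))
    = leg1 j (x'' *: A) * leg2 i j F /\
  leg2 i j F * (leg1 i (y *: B) * leg1 j (x' *: A) + leg1 j (y' *: B))
    = leg1 j (y'' *: B) * leg2 i j F.
Proof.
move=> ij [EX EY]; have fI := pair_fun_inj ij.
pose h : Op C p 2 -> Op C p n := leg2 i j.
have hM O1 O2 : h (O1 * O2) = h O1 * h O2 := legsM O1 O2 fI.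
have hD O1 O2 : h (O1 + O2) = h O1 + h O2 := legsD O1 O2 fI.
have h0 O : leg1 i O = h (leg1 ord0 O) by rewrite -(leg2_leg1 O ij).
have h1 O : leg1 j O = h (leg1 ord_max O) by rewrite -(leg2_leg1_max O ij).
rewrite (h0 (x *: A)) (h1 (x' *: A)) (h1 (x'' *: A)).
rewrite (h0 (y *: B)) (h1 (y' *: B)) (h1 (y'' *: B)) -/(h F).
clearbody h; split; [exact: (mul3_morph hM EX)|exact: (mul_add_morph hM hD EY)].
Qed.

Lemma leg1_commutes_unscale n (j : 'I_n) (D : Op C p 1) k (O : Op C p n) : k != 0 ->
  O * leg1 j (k *: D) = leg1 j (k *: D) * O -> O * leg1 j D = leg1 j D * O.
Proof.
by move=> k0; rewrite leg1Z -scalerAr -scalerAl => /(scalerI k0).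
Qed.

Local Notation i1 := (inord 0 : 'I_3).
Local Notation i2 := (inord 1 : 'I_3).
Local Notation i3 := (inord 2 : 'I_3).

Lemma codom_pair_fun21 i : (i \in codom (pair_fun i2 i1)) = (i != i3).
Proof.
apply/codomP/idP => [[k ->]|].
  by rewrite /pair_fun; case: ifP => _; apply: inord_neq.
case: i => [[|[|[|//]]]] Hi //= i_neq.
- by exists ord_max; apply: ord_inj; rewrite inordK.
- by exists ord0; apply: ord_inj; rewrite inordK.
- by case/negP: i_neq; apply/eqP/ord_inj; rewrite inordK.
Qed.

Lemma Tspec_exists F01 F12 F0_12 F01_2 x0 y0 x1 y1 x2 y2 x01 y01 x12 y12 x012 y012 :
  intertwines x0 y0 x1 y1 x01 y01 F01 ->
  intertwines x1 y1 x2 y2 x12 y12 F12 ->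
  intertwines x0 y0 x12 y12 x012 y012 F0_12 ->
  intertwines x01 y01 x2 y2 x012 y012 F01_2 ->
  invertible F01 -> invertible F12 -> invertible F0_12 -> invertible F01_2 ->
  x012 != 0 -> y012 != 0 ->
  exists2 T, invertible T & Tspec T F0_12 F12 F01 F01_2 i1 i2 i3.
Proof.
have n12 := @inord_neq 2 0 1 isT isT isT.
have n13 := @inord_neq 2 0 2 isT isT isT.
have n23 := @inord_neq 2 1 2 isT isT isT.
have n21 := @inord_neq 2 1 0 isT isT isT.
have n31 := @inord_neq 2 2 0 isT isT isT.
have n32 := @inord_neq 2 2 1 isT isT isT.
move=> /(intertwines_leg2 n12)[H1X H1Y] /(intertwines_leg2 n23)[G1X G1Y].
move=> /(intertwines_leg2 n13)[G2X G2Y] /(intertwines_leg2 n23)[H2X H2Y].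
move=> I01 I12 I0_12 I01_2 x_neq0 y_neq0.
have G1X1 := leg1_leg2_comm (x0 *: A) F12 n23 n12 n13.
have G1Y1 := leg1_leg2_comm (y0 *: B) F12 n23 n12 n13.
have H1X3 := leg1_leg2_comm (x2 *: A) F01 n12 n31 n32.
have H1Y3 := leg1_leg2_comm (y2 *: B) F01 n12 n31 n32.
have [K _ [HK KH]] := invertible_inv
  (invertibleM (invertible_leg2 n23 I01_2) (invertible_leg2 n12 I01)).
have [L _ [GL LG]] := invertible_inv
  (invertibleM (invertible_leg2 n13 I0_12) (invertible_leg2 n23 I12)).
have OX := triple_commute_X HK KH H1X G1X G2X H2X G1X1 H1X3.
have OY := triple_commute_Y HK KH H1Y G1X G1Y G2Y H2Y G1Y1 H1X3 H1Y3.
have [OO' O'O O_H] := quotient_inverses HK KH GL LG.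
(* The nonzero scalars of the fused weight are stripped, leaving commutation with A and B
   themselves. *)
move/(leg1_commutes_unscale x_neq0): OX => OX.
move/(leg1_commutes_unscale y_neq0): OY => OY.
have O'X := inverse_commutes OO' O'O OX.
have O'Y := inverse_commutes OO' O'O OY.
have comm21 O := @commutant_leg2 _ _ _ _ _ _ _ _ _ O
  w_prim A_ebasis B_ebasis n21 codom_pair_fun21.
(* The inverse of the quotient lies in the same commutant and supplies [T']; injectivity of [leg2]
   shows that it inverts [T]. *)
have [T TE] := comm21 _ OX OY; have [T' T'E] := comm21 _ O'X O'Y.
exists T; last by rewrite /Tspec -TE.
have E1 : leg2 i2 i1 (T' * T) = 1 by rewrite (leg2M T' T n21) -TE -T'E.
have E2 : leg2 i2 i1 (T * T') = 1 by rewrite (leg2M T T' n21) -TE -T'E.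
have L1 := leg2_1 C p n21.
exists T'; split; apply: (leg2_inj n21); first exact: etrans E1 (esym L1).
exact: etrans E2 (esym L1).
Qed.
End TripleExistence.

(** * Regular sequences of weights *)

Section TensorPowers.
Context (C : fieldType) (p : nat) (w : C).
Local Notation N := p.+1.
Hypotheses (oddN : odd N) (w_prim : N.-primitive_root w).

(** The weight (x, y) appears as the scalars of X^N and Y^N; [tensor_qpair] shows that tensor
    products multiply weights by [wmul]. *)
Definition qpair n (V : genact C p n) (x y : C) :=
  [/\ actX V ^+ N = x *: 1, actY V ^+ N = y *: 1
    & actX V * actY V = w *: (actY V * actX V)].

Lemma qpair_ring (A : algType C) (XV YV XW YW : A) (x y x' y' : C) : y' != 0 ->
  XV ^+ N = x *: 1 -> YV ^+ N = y *: 1 -> XV * YV = w *: (YV * XV) ->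
  XW ^+ N = x' *: 1 -> YW ^+ N = y' *: 1 -> XW * YW = w *: (YW * XW) ->
  XV * XW = XW * XV -> XV * YW = YW * XV -> YV * XW = XW * YV -> YV * YW = YW * YV ->
  [/\ (XV * XW) ^+ N = (x * x') *: 1, (YV * XW + YW) ^+ N = (y * x' + y') *: 1
    & XV * XW * (YV * XW + YW) = w *: ((YV * XW + YW) * (XV * XW))].
Proof.
move=> y'0 XVN YVN XYV XWN YWN XYW cXX cXY cYX cYY; split.
- by rewrite exprMn_comm // XVN XWN -scalerAl mul1r scalerA.
(* As YW^N = y' is nonzero and N = p + 1, this is the inverse of [YW] required by the q-binomial
   formula. *)
- pose v' := y'^-1 *: YW ^+ p.
  rewrite (@exprD_qcomm _ _ _ _ oddN w_prim _ _ v').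
  + by rewrite exprMn_comm // YVN XWN YWN -scalerAl mul1r scalerA scalerDl.
  + by rewrite -mulrA XYW -scalerAr [YV * (YW * _)]mulrA cYY -mulrA.
  + by rewrite -scalerAr -exprS YWN scalerA mulVf ?scale1r.
  + by rewrite -scalerAl -exprSr YWN scalerA mulVf ?scale1r.
- rewrite mulrDr mulrDl scalerDr; congr (_ + _).
    rewrite !mulrA -[XV * XW * YV]mulrA -cYX [XV * (YV * XW)]mulrA XYV -!scalerAl.
    by rewrite -[YV * XW * XV]mulrA -cXX [YV * (XV * XW)]mulrA.
  by rewrite -mulrA XYW -scalerAr [XV * (YW * _)]mulrA cXY -mulrA.
Qed.

Lemma qpair_scale (A : algType C) (a b : A) (x y : C) :
  a ^+ N = 1 -> b ^+ N = 1 -> a * b = w *: (b * a) ->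
  [/\ (x *: a) ^+ N = x ^+ N *: 1, (y *: b) ^+ N = y ^+ N *: 1
    & x *: a * (y *: b) = w *: (y *: b * (x *: a))].
Proof.
move=> aN bN ab; rewrite !exprZn aN bN; split=> //.
by rewrite -!scalerAl -!scalerAr ab !scalerA [x * y * w]mulrC [x * y]mulrC mulrA.
Qed.

Lemma tensor_qpair m n (V : genact C p m) (W : genact C p n) x y x' y' :
  y' != 0 -> qpair V x y -> qpair W x' y' ->
  qpair (tensor V W) (x * x') (y * x' + y').
Proof.
move=> y'0 [XV YV XYV] [XW YW XYW].
have lI := @lshift_inj m n; have rI := @rshift_inj m n.
have lX (O : Op C p m) k : legs (@lshift m n) (O ^+ k) = legs (@lshift m n) O ^+ k.
  by elim: k => [|k IH]; rewrite ?legs1 // !exprS legsM // IH.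
have rX (O : Op C p n) k : legs (@rshift m n) (O ^+ k) = legs (@rshift m n) O ^+ k.
  by elim: k => [|k IH]; rewrite ?legs1 // !exprS legsM // IH.
have lr O1 O2 : legs (@lshift m n) O1 * legs (@rshift m n) O2
    = legs (@rshift m n) O2 * legs (@lshift m n) O1 :> Op C p (m + n).
  by apply: legs_comm => // i j; rewrite eq_lrshift.
have lZ k : legs (@lshift m n) (k *: 1) = k *: 1 :> Op C p (m + n) by rewrite legsZ // legs1.
have rZ k : legs (@rshift m n) (k *: 1) = k *: 1 :> Op C p (m + n) by rewrite legsZ // legs1.
apply: qpair_ring; rewrite ?lr -?lX -?rX ?XV ?YV ?XW ?YW //.
- by rewrite -!legsM // XYV legsZ.
- by rewrite -!legsM // XYW legsZ.
Qed.

Lemma qpair_invertibleY n (V : genact C p n) x y :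
  qpair V x y -> invertible (actY V) -> y != 0.
Proof.
move=> [_ YN _] /(invertibleX N); rewrite YN => /invertible_inv[g _ [yg _]].
by apply: contra_eq_neq yg => ->; rewrite scale0r mul0r eq_sym oner_eq0.
Qed.
End TensorPowers.

Section Regular.
Context (R : realType) (p : nat).
Local Notation C := R[i].
Local Notation N := p.+1.
Local Notation w := (q R p ^+ 2).
Context (oddN : odd N) (rt : root_choice C N).

(** Bracketed to the right, following the recursion of [Vtens]. *)
Fixpoint wprod (l : weight C) (s : seq (weight C)) : weight C :=
  if s is l1 :: s1 then (l ** wprod l1 s1) else l.

Lemma rt_neq0 z : z != 0 -> rt z != 0.
Proof.
move=> z0; have E := nrootK rt z0; apply: contra_neq z0 => rz.
by rewrite -E rz expr0n.
Qed.

Lemma opA_ebasis t : opA R p (ebasis C t) = w ^+ t ord0 *: ebasis C t.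
Proof. by rewrite on_basis_ebasis exprM. Qed.

Lemma opB_ebasis t : opB R p (ebasis C t) = ebasis C [ffun k => ordS (t k)].
Proof. by rewrite on_basis_ebasis. Qed.

Lemma Vrep_qpair l : nonsingular l -> qpair w (Vrep rt l) l.1 l.2.
Proof.
case/andP => x0 y0.
have wP := q2_prim R p.
have AN := A_N wP opA_ebasis; have BN := B_N opB_ebasis.
have AB := mulAB wP opA_ebasis opB_ebasis.
have [E1 E2 E3] := qpair_scale (rt l.1) (rt l.2) AN BN AB.
move: E1 E2; rewrite (nrootK rt x0) (nrootK rt y0) => E1 E2.
exact: And3 E1 E2 E3.
Qed.

Lemma regular_infix s1 s2 : infix s1 s2 -> regular rt s2 -> regular rt s1.
Proof.
move=> s12 [/allP ns Vs]; split; first by apply/allP => l /(mem_infix s12)/ns.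
by move=> l s' /infix_trans/(_ s12)/Vs.
Qed.

(** Induction on the tail: its weight has a nonzero second coordinate, so Y^N can be computed on the
    whole product, and invertibility of Y there makes the next second coordinate nonzero. *)
Lemma regular_qpair l s : regular rt (l :: s) ->
  qpair w (Vtens rt l s) (wprod l s).1 (wprod l s).2 /\ nonsingular (wprod l s).
Proof.
elim: s l => [|l1 s IH] l reg.
  have [/andP[nl _] _] := reg; split=> //; exact: Vrep_qpair.
have [/andP[nl _] Vs] := reg.
have [|qV /andP[x0 y0]] := IH l1.
  exact: regular_infix (infix_cons _ _) reg.
have qt := tensor_qpair oddN (q2_prim R p) y0 (Vrep_qpair nl) qV.
split=> //; apply/andP; split; first by rewrite /= mulf_neq0 //; case/andP: nl.
by apply: (qpair_invertibleY qt); have [] := Vs l (l1 :: s) (infix_refl _).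
Qed.

Lemma regular_nonsingular l s s2 : regular rt s2 -> infix (l :: s) s2 ->
  nonsingular (wprod l s).
Proof. by move=> reg s12; have [] := regular_qpair (regular_infix s12 reg). Qed.
End Regular.

(** * The operators of the theorem *)

(** The scalars x, y and their primed forms will be N-th roots of weight coordinates; the last two
    equations are the definitions of c and a cleared of their denominator. *)
Lemma scale_relations (C : fieldType) (A : algType C) (F a1 a2 b1 b2 : A)
    (k a c x y x' y' x'' y'' : C) :
  F * (a1 * a2) = k *: (a2 * F) -> F * (c *: b2 - a *: (b1 * a2)) = b2 * F ->
  x'' = k * x * x' -> y' = y'' * c -> y * x' = - (y'' * a) ->
  F * ((x *: a1) * (x' *: a2)) = x'' *: a2 * F /\
  F * ((y *: b1) * (x' *: a2) + y' *: b2) = y'' *: b2 * F.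
Proof.
move=> FX FY Ex Ey' Eyx; split.
  by rewrite -scalerAl -!scalerAr FX !scalerA -scalerAl Ex mulrC mulrA.
rewrite -[RHS]scalerAl -FY scalerAr scalerBr !scalerA -Ey' -scalerAl -scalerAr.
by rewrite scalerA Eyx scaleNr addrC.
Qed.

Lemma scaled_intertwines (C : fieldType) p (A B : Op C p 1) (F : Op C p 2) (k : C)
    (a c x y x' y' x'' y'' : C) :
  F * (leg1 ord0 A * leg1 ord_max A) = k *: (leg1 ord_max A * F) ->
  F * (c *: leg1 ord_max B - a *: (leg1 ord0 B * leg1 ord_max A)) = leg1 ord_max B * F ->
  x'' = k * x * x' -> y' = y'' * c -> y * x' = - (y'' * a) ->
  intertwines A B x y x' y' x'' y'' F.
Proof.
move=> FX FY Ex Ey' Eyx; rewrite /intertwines !leg1Z.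
exact: scale_relations FX FY Ex Ey' Eyx.
Qed.

Section WeightFactor.
Context (C : fieldType) (N : nat) (w a c : C).
Hypotheses (oddN : odd N) (w_prim : N.-primitive_root w) (ca : c ^+ N - a ^+ N = 1).

Lemma sub_root_neq0 j : c - a * w ^+ j != 0.
Proof.
rewrite subr_eq0; apply: contra_eq_neq ca => ->.
rewrite exprMn -exprM mulnC exprM (prim_expr_order w_prim) expr1n mulr1 subrr.
by rewrite eq_sym oner_eq0.
Qed.

(** The product over a full period is the inverse of c^N - a^N; this gives the N-periodicity of
    w(a,c|n). *)
Lemma prod_sub_root_inv : \prod_(1 <= j < N.+1) (c - a * w ^+ j)^-1 = 1.
Proof.
rewrite big_add1 /=.
transitivity (\prod_(0 <= j < N) (c - (a * w) * w ^+ j))^-1.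
  by rewrite -prodfV; apply: eq_bigr => j _; rewrite exprS mulrA.
by rewrite (prod_sub_root oddN w_prim) exprMn (prim_expr_order w_prim) mulr1 ca invr1.
Qed.
End WeightFactor.

Section ConcreteF.
Context (R : realType) (p : nat) (oddN : odd p.+1).
Local Notation C := R[i].
Local Notation N := p.+1.
Local Notation w := (q R p ^+ 2).
Context (rt : root_choice C N) (zeta : C -> C -> C).
Hypothesis zeta_neq0 : forall a c : C, c ^+ N - a ^+ N = 1 -> zeta a c != 0.

Lemma mrootE z z' : z != 0 -> z' != 0 ->
  rt (z * z') = w ^+ mroot rt z z' * rt z * rt z'.
Proof.
move=> z0 z'0; rewrite /mroot; case: pickP => [m /eqP|no] /=; first by rewrite exprM.
have r0 := rt_neq0 rt z0; have r'0 := rt_neq0 rt z'0.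
have: (rt (z * z') / (rt z * rt z')) ^+ N = 1.
  by rewrite expr_div_n exprMn !nrootK ?mulf_neq0 // divff ?mulf_neq0.
case/(prim_rootP (q2_prim R p)) => m E; have := no m.
by rewrite exprM -mulrA -E divfK ?mulf_neq0 // eqxx.
Qed.

Lemma opS_ebasis t : opS R p (ebasis C t) = ebasis C
  [ffun k : 'I_2 => if k == ord0 then t ord0 else t ord0 + t ord_max].
Proof. by rewrite on_basis_ebasis. Qed.

Lemma wfunE a c i : wfun p a c i = \prod_(1 <= j < i.+1) (c - a * w ^+ j)^-1.
Proof. by apply: eq_bigr => j _; rewrite exprM. Qed.

Lemma at1_1 (O : Op C p 1) : at1 1 O = leg1 ord0 O :> Op C p 2.
Proof.
rewrite /at1 /leg1; have -> // : inord 1.-1 = ord0 :> 'I_2.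
by apply: ord_inj; rewrite inordK.
Qed.

Lemma at1_2 (O : Op C p 1) : at1 2 O = leg1 ord_max O :> Op C p 2.
Proof.
rewrite /at1 /leg1; have -> // : inord 2.-1 = ord_max :> 'I_2.
by apply: ord_inj; rewrite inordK.
Qed.

Lemma site2B_inv : exists2 Bi : Op C p 2, ((at1 2 (opB R p) : Op C p 2)^-1)%VF = Bi &
  leg1 ord_max (opB R p) * Bi = 1 /\ Bi * leg1 ord_max (opB R p) = 1.
Proof.
(* B^N = 1 with N = p + 1, so B^p is the inverse. *)
rewrite at1_2; apply: invertible_inv; exists (leg1 ord_max (opB R p) ^+ p).
have BN := siteB_N (@opB_ebasis R p) (ord_max : 'I_2).
by split; [exact: etrans (esym (exprSr _ _)) BN|exact: etrans (esym (exprS _ _)) BN].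
Qed.

Lemma opFE x y x' y' d a c (Bi : Op C p 2) : ((at1 2 (opB R p) : Op C p 2)^-1)%VF = Bi ->
  (leg1 ord0 (opB R p) * leg1 ord_max (opA R p) * Bi) ^+ N = 1 ->
  d = rt (y * x' + y') -> a = - (rt y * rt x' / d) -> c = rt y' / d ->
  opF rt zeta (x, y) (x', y') =
  Bi ^+ mroot rt x x' * opS R p * fcalc N w (fun i => zeta a c * wfun p a c i)
    (leg1 ord0 (opB R p) * leg1 ord_max (opA R p) * Bi).
Proof.
move=> BiE UN -> -> ->; rewrite -(PhiE zeta UN) /opF BiE at1_1 at1_2 powopE.
by [].
Qed.

Lemma opF_spec (x y x' y' : C) : x != 0 -> y != 0 -> x' != 0 -> y' != 0 ->
  y * x' + y' != 0 ->
  invertible (opF rt zeta (x, y) (x', y')) /\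
  intertwines (opA R p) (opB R p) (rt x) (rt y) (rt x') (rt y')
    (rt (x * x')) (rt (y * x' + y')) (opF rt zeta (x, y) (x', y')).
Proof.
move=> x0 y0 x'0 y'0 d0; have [Bi BiE [b2Bi Bib2]] := site2B_inv.
have wP := q2_prim R p; have Nn0 := natr_neq0 R p.
have AE := @opA_ebasis R p; have BE := @opB_ebasis R p; have SE := opS_ebasis.
have UN := U_N oddN wP AE BE b2Bi Bib2.
have rd0 := rt_neq0 rt d0.
pose d := rt (y * x' + y'); pose a := - (rt y * rt x' / d); pose c := rt y' / d.
rewrite (@opFE x y x' y' d a c Bi BiE UN (erefl d) (erefl a) (erefl c)).
(* Since [N] is odd, the sign in a survives the N-th power, and the left side becomes (y' + y x')/(y
   x' + y'). *)
have ca : c ^+ N - a ^+ N = 1.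
  rewrite exprNn -signr_odd oddN expr1 mulN1r opprK !expr_div_n exprMn !nrootK //.
  by rewrite -mulrDl addrC divff.
have cq0 := sub_root_neq0 wP ca.
have z0 := zeta_neq0 ca.
set g := fun i => _; have gS i : g i.+1 * (c - a * w ^+ i.+1) = g i.
  by rewrite /g !wfunE big_nat_recr //= -!mulrA mulVf ?mulr1.
have gN : g N = g 0 by rewrite /g !wfunE (prod_sub_root_inv oddN wP ca) big_geq.
have g0 i : g i != 0.
  by rewrite /g wfunE mulf_neq0 // prodf_seq_neq0; apply/allP => j _; rewrite invr_neq0.
split; first exact: (intertwiner_invertible oddN Nn0 wP AE BE SE b2Bi Bib2).
apply: (scaled_intertwines (intertwiner_X wP AE BE SE b2Bi Bib2 _ _)
   (intertwiner_Y oddN Nn0 wP AE BE SE b2Bi Bib2 _ gS gN)).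
- exact: mrootE.
- by rewrite mulrC divfK.
- by rewrite /a mulrN opprK mulrCA divff // mulr1.
Qed.
End ConcreteF.

(** * From four factors back to the three multiplicity spaces *)

Section Descent.
Local Opaque legs on_basis leg1 leg2 at2.
Context (C : fieldType) (p : nat).
Local Notation i1 := (inord 0 : 'I_3).
Local Notation i2 := (inord 1 : 'I_3).
Local Notation i3 := (inord 2 : 'I_3).

(** No T acts on the factor of the fused module, so injectivity of [legs] allows it to be dropped.
    The embedding lists the factors as c, b, a because T enters its defining equation as T_21. *)
Lemma pentagon_descent (T0_1_23 T01_2_3 T1_2_3 T0_12_3 T0_1_2 : Op C p 2) n
    (a b c : 'I_n) : a != b -> a != c -> b != c ->
  leg2 b a T0_1_23 * leg2 c b T01_2_3 =
  leg2 c b T1_2_3 * leg2 c a T0_12_3 * leg2 b a T0_1_2 ->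
  leg2 i2 i3 T0_1_23 * leg2 i1 i2 T01_2_3 =
  leg2 i1 i2 T1_2_3 * leg2 i1 i3 T0_12_3 * leg2 i2 i3 T0_1_2.
Proof.
move=> ab ac bc E.
have [ba ca cb] : [/\ b != a, c != a & c != b] by rewrite ![_ == a]eq_sym [c == b]eq_sym.
have fI := triple_fun_inj cb ca ba.
have n12 := @inord_neq 2 0 1 isT isT isT.
have n13 := @inord_neq 2 0 2 isT isT isT.
have n23 := @inord_neq 2 1 2 isT isT isT.
pose h : Op C p 3 -> Op C p n := legs (triple_fun c b a).
have hI : injective h := legs_inj fI.
have hM O1 O2 : h (O1 * O2) = h O1 * h O2 := legsM O1 O2 fI.
have hL i j a' b' : i != j -> triple_fun c b a i = a' -> triple_fun c b a j = b' ->
    forall O, leg2 a' b' O = h (leg2 i j O).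
  by move=> ij <- <- O; rewrite -legs_leg2E.
have h12 := hL _ _ _ _ n12 (triple_fun1 c b a) (triple_fun2 c b a).
have h13 := hL _ _ _ _ n13 (triple_fun1 c b a) (triple_fun3 c b a).
have h23 := hL _ _ _ _ n23 (triple_fun2 c b a) (triple_fun3 c b a).
clearbody h; apply: hI.
move: E; rewrite (h23 T0_1_23) (h12 T01_2_3) (h12 T1_2_3) (h13 T0_12_3) (h23 T0_1_2).
by rewrite -!hM.
Qed.

Lemma lfun_quotient_eq n (t f1 f2 f3 f4 : Op C p n) :
  invertible f3 -> invertible f4 ->
  (f1 \o f2 \o f3^-1 \o f4^-1)%VF = t <-> t * (f4 * f3) = f1 * f2.
Proof.
move=> /invertible_inv[k3 -> [fk3 kf3]] /invertible_inv[k4 -> [fk4 kf4]].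
rewrite !mulOpE; split=> [<-|E].
  by rewrite mulrA -[_ * k4 * f4]mulrA kf4 mulr1 -mulrA kf3 mulr1.
by rewrite -E mulrA -[_ * f3 * k3]mulrA fk3 mulr1 -mulrA fk4 mulr1.
Qed.

Lemma pentagon_at2 (F01 F12 F23 F0_12 F01_2 F1_23 F12_3 F01_23 F0_123 F012_3
    T0_1_23 T01_2_3 T1_2_3 T0_12_3 T0_1_2 : Op C p 2) :
  invertible F01 -> invertible F01_2 -> invertible F012_3 ->
  Tspec T0_1_23 F0_123 F1_23 F01 F01_23 i1 i2 i3 ->
  Tspec T01_2_3 F01_23 F23 F01_2 F012_3 i1 i2 i3 ->
  Tspec T1_2_3 F1_23 F23 F12 F12_3 i1 i2 i3 ->
  Tspec T0_12_3 F0_123 F12_3 F0_12 F012_3 i1 i2 i3 ->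
  Tspec T0_1_2 F0_12 F12 F01 F01_2 i1 i2 i3 ->
  (at2 2 3 T0_1_23 \o at2 1 2 T01_2_3)%VF =
  (at2 1 2 T1_2_3 \o at2 1 3 T0_12_3 \o at2 2 3 T0_1_2)%VF :> Op C p 3.
Proof.
move=> I01 I01_2 I012_3 T1 T2 T3 T4 T5.
pose o i : 'I_4 := inord i.
have o_neq i j : (i <= 3)%N -> (j <= 3)%N -> i != j -> o i != o j by apply: inord_neq.
have o01 := o_neq 0 1 isT isT isT; have o02 := o_neq 0 2 isT isT isT.
have o12 := o_neq 1 2 isT isT isT.
have E12 O := @at2E C p 2 1 2 O isT isT isT.
have E13 O := @at2E C p 2 1 3 O isT isT isT.
have E23 O := @at2E C p 2 2 3 O isT isT isT.
rewrite (E23 T0_1_23) (E12 T01_2_3) (E12 T1_2_3) (E13 T0_12_3) (E23 T0_1_2).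
apply: (pentagon_descent o01 o02 o12).
apply: (pentagon_of_Tspec (d := o 3) _ I01 I01_2 I012_3).
  by rewrite /= !inE !negb_or o01 o02 o12 !o_neq.
move=> x y z xy xz yz; split; apply: (Tspec_transport xy xz yz).
- exact: T1.
- exact: T2.
- exact: T3.
- exact: T4.
- exact: T5.
Qed.
End Descent.

(** * The chosen operators T satisfy their defining equation *)

Section ConcreteT.
Local Opaque legs on_basis leg1 leg2.
Context (R : realType) (p : nat) (oddN : odd p.+1).
Local Notation C := R[i].
Local Notation N := p.+1.
Context (rt : root_choice C N) (zeta : C -> C -> C).
Hypothesis zeta_neq0 : forall a c : C, c ^+ N - a ^+ N = 1 -> zeta a c != 0.
Local Notation F := (opF rt zeta).
Local Notation i1 := (inord 0 : 'I_3).
Local Notation i2 := (inord 1 : 'I_3).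
Local Notation i3 := (inord 2 : 'I_3).

Lemma wmulA : associative (@wmul C).
Proof.
move=> [x y] [x' y'] [x'' y'']; rewrite /wmul /=; congr (_, _); first by rewrite mulrA.
by rewrite mulrDl addrA mulrA.
Qed.

Lemma opF_invertible l l' : nonsingular l -> nonsingular l' ->
  nonsingular (l ** l') -> invertible (F l l').
Proof.
case: l l' => [x y] [x' y'] /andP[x0 y0] /andP[x'0 y'0] /andP[_ d0].
by have [] := opF_spec oddN rt zeta_neq0 x0 y0 x'0 y'0 d0.
Qed.

Lemma opF_intertwines l l' : nonsingular l -> nonsingular l' ->
  nonsingular (l ** l') -> intertwines (opA R p) (opB R p) (rt l.1) (rt l.2)
    (rt l'.1) (rt l'.2) (rt (l ** l').1) (rt (l ** l').2) (F l l').
Proof.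
case: l l' => [x y] [x' y'] /andP[x0 y0] /andP[x'0 y'0] /andP[_ d0].
by have [] := opF_spec oddN rt zeta_neq0 x0 y0 x'0 y'0 d0.
Qed.

Lemma is_opTE l l' l'' (T : Op C p 2) :
  invertible (F l l') -> invertible (F (l ** l') l'') ->
  is_opT rt zeta l l' l'' T <-> invertible T /\
    Tspec T (F l (l' ** l'')) (F l' l'') (F l l') (F (l ** l') l'') i1 i2 i3.
Proof.
move=> I01 I01_2; rewrite /is_opT !at2E //.
have n12 := @inord_neq 2 0 1 isT isT isT.
have n23 := @inord_neq 2 1 2 isT isT isT.
have Q f1 f2 t := lfun_quotient_eq t f1 f2
  (invertible_leg2 n12 I01) (invertible_leg2 n23 I01_2).
by split=> -[IT E]; split=> //; apply/Q.
Qed.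

Lemma opT_Tspec l l' l'' :
  nonsingular l -> nonsingular l' -> nonsingular l'' ->
  nonsingular (l ** l') -> nonsingular (l' ** l'') -> nonsingular (l ** l' ** l'') ->
  Tspec (opT rt zeta l l' l'') (F l (l' ** l'')) (F l' l'') (F l l') (F (l ** l') l'')
    i1 i2 i3.
Proof.
move=> n0 n1 n2 n01 n12 n012; have n0_12 := n012; rewrite -wmulA in n0_12.
have F01 := opF_intertwines n0 n1 n01; have F12 := opF_intertwines n1 n2 n12.
have F0_12 := opF_intertwines n0 n12 n0_12; have F01_2 := opF_intertwines n01 n2 n012.
rewrite wmulA in F0_12.
have I01 := opF_invertible n0 n1 n01; have I12 := opF_invertible n1 n2 n12.
have I0_12 := opF_invertible n0 n12 n0_12; have I01_2 := opF_invertible n01 n2 n012.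
have /andP[x0 y0] := n012.
have [T IT ET] := Tspec_exists (q2_prim R p) (@opA_ebasis R p) (@opB_ebasis R p)
  F01 F12 F0_12 F01_2 I01 I12 I0_12 I01_2 (rt_neq0 rt x0) (rt_neq0 rt y0).
have exT : exists T, is_opT rt zeta l l' l'' T by exists T; apply/is_opTE.
(* Existence ensures that [xget] returns a solution and not its default 0. *)
by have /is_opTE[] := xgetPex 0 exT.
Qed.
End ConcreteT.

Theorem proposition2p24 (R : realType) (p : nat) (oddN : odd p.+1)
    (rt : root_choice R[i] p.+1) (zeta : R[i] -> R[i] -> R[i])
    (zeta_neq0 : forall a c : R[i], c ^+ p.+1 - a ^+ p.+1 = 1 -> zeta a c != 0)
    (l l' l'' l''' : weight R[i])
    (reg : regular rt [:: l; l'; l''; l''']) :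
  let T := opT rt zeta in
  (at2 2 3 (T l l' (l'' ** l''')) \o at2 1 2 (T (l ** l') l'' l'''))%VF =
  (at2 1 2 (T l' l'' l''') \o at2 1 3 (T l (l' ** l'') l''') \o
     at2 2 3 (T l l' l''))%VF
  :> Op R[i] p 3.
Proof.
move=> T.
(* Every product of consecutive weights is non-singular; it comes bracketed to the right and is
   rebracketed afterwards to match the arguments of T. *)
have ns l1 s s1 s2 : [:: l; l'; l''; l'''] = s1 ++ (l1 :: s) ++ s2 ->
    nonsingular (wprod l1 s).
  by move=> E; apply: (regular_nonsingular oddN reg); rewrite E; apply: infix_infix.
have n0 := ns l [::] [::] _ erefl; have n1 := ns l' [::] [:: _] _ erefl.
have n2 := ns l'' [::] [:: _; _] _ erefl; have n3 := ns l''' [::] [:: _; _; _] _ erefl.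
have n01 := ns l [:: l'] [::] _ erefl; have n12 := ns l' [:: l''] [:: _] _ erefl.
have n23 := ns l'' [:: l'''] [:: _; _] _ erefl.
have n012 := ns l [:: l'; l''] [::] _ erefl.
have n123 := ns l' [:: l''; l'''] [:: _] _ erefl.
have n0123 := ns l [:: l'; l''; l'''] [::] _ erefl.
move: n0 n1 n2 n3 n01 n12 n23 n012 n123 n0123 => /=.
move=> n0 n1 n2 n3 n01 n12 n23 n012 n123 n0123.
have n012' := n012; have n123' := n123; rewrite wmulA in n012'; rewrite wmulA in n123'.
have n01_23 := n0123; rewrite wmulA in n01_23.
have n012_3 := n01_23; rewrite wmulA in n012_3.
have F01 := opF_invertible oddN rt zeta_neq0 n0 n1 n01.
have F01_2 := opF_invertible oddN rt zeta_neq0 n01 n2 n012'.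
have F012_3 := opF_invertible oddN rt zeta_neq0 n012' n3 n012_3.
have T1 := opT_Tspec oddN rt zeta_neq0 n0 n1 n23 n01 n123 n01_23.
have T2 := opT_Tspec oddN rt zeta_neq0 n01 n2 n3 n012' n23 n012_3.
have T3 := opT_Tspec oddN rt zeta_neq0 n1 n2 n3 n12 n23 n123'.
have n0_12_3 := n012_3; rewrite -(wmulA l l' l'') in n0_12_3.
have T4 := opT_Tspec oddN rt zeta_neq0 n0 n12 n3 n012 n123' n0_12_3.
have T5 := opT_Tspec oddN rt zeta_neq0 n0 n1 n2 n01 n12 n012'.
(* The F's that this relation shares with the others must carry identically bracketed weights. *)
rewrite -(wmulA l' l'' l''') (wmulA l l' l'') in T4.
exact: (pentagon_at2 F01 F01_2 F012_3 T1 T2 T3 T4 T5).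
Qed.
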